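(* Let $M$ be a compact complex parallelizable manifold. Then any left-invariant Hermitian metric on $M$ is a CYT metric. Moreover, the Ricci forms $\rho^t$ of all the canonical Hermitian connections $\nabla^t$, $t\in\mathbb R$, of such a metric vanish.
   Context: A compact complex parallelizable manifold is a compact complex manifold whose holomorphic tangent bundle is holomorphically trivial; it is a quotient of a complex Lie group $G^c$ by a cocompact lattice $\Gamma$. A left-invariant metric on $M$ is one induced on the quotient by $\Gamma$ (acting by left translations) from a left-invariant Hermitian metric on $G^c$. On a Hermitian manifold $(M,J,g)$ of complex dimension $n$, the canonical connections $\nabla^t$, $t\in\mathbb R$, are the Hermitian connections $\nabla^t=\frac{1+t}{2}\nabla^{1}+\frac{1-t}{2}\nabla^{-1}$, where $\nabla^1$ is the Chern connection and $\nabla^{-1}=\nabla^B$ is the KT (Bismut) connection, i.e. the unique connection preserving $g$ and $J$ with totally skew-symmetric torsion. The Ricci form $\rho^t$ is the real closed 2-form such that $i\rho^t$ is (up to sign convention) the curvature of the connection induced by $\nabla^t$ on the anticanonical bundle $K^{-1}$. The metric is called CYT (Calabi-Yau with torsion) if $\rho^B=\rho^{-1}=0$, equivalently if the restricted holonomy group of $\nabla^B$ is contained in $SU(n)$. *)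

(* Defs.v *)
From HB Require Import structures.
From mathcomp Require Import all_boot all_order all_algebra.
From mathcomp Require Import all_classical all_reals all_analysis.
From mathcomp Require Import complex.

Set Implicit Arguments.
Unset Strict Implicit.
Unset Printing Implicit Defensive.

Import Order.TTheory GRing.Theory Num.Theory.
Import numFieldNormedType.Exports.

Local Open Scope classical_set_scope.
Local Open Scope complex_scope.
Local Open Scope ring_scope.

Section Calculus.
Context {R : realType}.

Fixpoint iter_derive (E F : normedModType R) (vs : seq E) (f : E -> F)
  : E -> F :=
  if vs is v :: vs' then iter_derive vs' (fun x => 'D_v f x) else f.

(* On finite-dimensional spaces this is C^oo: every iterated directional
   derivative (including f itself) is Frechet differentiable at every point
   of the open set U. *)
Definition smooth_on (E F : normedModType R) (U : set E) (f : E -> F) :=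
  forall (vs : seq E) x, U x -> differentiable (iter_derive vs f) x.

(* Smooth, with a differential intertwining the complex structures JE and JF
   (the Cauchy-Riemann equations). *)
Definition holomorphic_wrt (E F : normedModType R) (JE : E -> E) (JF : F -> F)
    (U : set E) (f : E -> F) :=
  smooth_on U f /\
  forall x X, U x -> 'D_(JE X) f x = JF ('D_X f x).

End Calculus.

(* C^n as a real normed space: (a, b) stands for a + i b. *)
Definition Cspace (R : realType) (n : nat) : normedModType R :=
  ('rV[R]_n * 'rV[R]_n)%type.

Section ComplexStructure.
Context {R : realType} {n : nat}.

Definition mulI (X : Cspace R n) : Cspace R n := (- X.2, X.1).

Definition mulI2 (X : (Cspace R n * Cspace R n)%type)
  : (Cspace R n * Cspace R n)%type := (mulI X.1, mulI X.2).

Definition basisC (k : 'I_n) : Cspace R n := (delta_mx 0 k, 0).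

(* Complex trace of an endomorphism of C^n that commutes with mulI. *)
Definition traceC (A : Cspace R n -> Cspace R n) : R[i] :=
  \sum_(k < n) ((A (basisC k)).1 0 k +i* (A (basisC k)).2 0 k).

End ComplexStructure.

(* cmap and cinv are total functions; they are only meaningful on cdom and
   cimg, between which they are inverse homeomorphisms. *)
Record chart (R : realType) (n : nat) (T : topologicalType) := Chart {
  cdom : set T;
  cimg : set (Cspace R n);
  cmap : T -> Cspace R n;
  cinv : Cspace R n -> T;
  cdom_open : open cdom;
  cimg_open : open cimg;
  cmap_img : forall p, cdom p -> cimg (cmap p);
  cinv_dom : forall x, cimg x -> cdom (cinv x);
  cmapK : forall p, cdom p -> cinv (cmap p) = p;
  cinvK : forall x, cimg x -> cmap (cinv x) = x;
  cmap_cont : forall p, cdom p -> {for p, continuous cmap};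
  cinv_cont : forall x, cimg x -> {for x, continuous cinv} }.

Section LocalExpression.
Context {R : realType} {n m : nat} {S T : topologicalType}.

Definition loc (f : S -> T) (c : chart R n S) (d : chart R m T)
  : Cspace R n -> Cspace R m := fun x => cmap d (f (cinv c x)).

Definition loc_dom (f : S -> T) (c : chart R n S) (d : chart R m T)
  : set (Cspace R n) := [set x | cimg c x /\ cdom d (f (cinv c x))].

End LocalExpression.

Record complexManifold (R : realType) (n : nat) := ComplexManifold {
  carrier :> topologicalType;
  atlas : set (chart R n carrier);
  manifold_hausdorff : hausdorff_space carrier;
  manifold_second_countable : @second_countable carrier;
  atlas_cover : forall p, exists c, atlas c /\ cdom c p;
  atlas_compatible : forall c d, atlas c -> atlas d ->
    holomorphic_wrt mulI mulI (loc_dom id c d) (loc id c d) }.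

Arguments atlas {R n} _ _.

Section HolomorphicMaps.
Context {R : realType} {n m : nat}.
Variables (M : complexManifold R n) (N : complexManifold R m).

(* A is meant to be open. *)
Definition holomorphic_on (A : set M) (f : M -> N) :=
  (forall p, A p -> {for p, continuous f}) /\
  forall c d, atlas M c -> atlas N d ->
    holomorphic_wrt mulI mulI
      (loc_dom f c d `&` [set x | A (cinv c x)]) (loc f c d).

End HolomorphicMaps.

Section Parallelizable.
Context {R : realType} {n : nat} (M : complexManifold R n).

(* A vector field is given by its components in every chart; a real vector X
   stands for the holomorphic tangent vector X - i J X. *)
Definition vector_field := chart R n M -> Cspace R n -> Cspace R n.

Definition is_holomorphic_vector_field (Z : vector_field) :=
  (forall c, atlas M c -> holomorphic_wrt mulI mulI (cimg c) (Z c)) /\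
  forall c d, atlas M c -> atlas M d -> forall x, loc_dom id c d x ->
    Z d (loc id c d x) = 'D_(Z c x) (loc id c d) x.

(* A trivialization of the holomorphic tangent bundle is a global holomorphic
   frame: n holomorphic vector fields, C-linearly independent at each point. *)
Definition complex_parallelizable :=
  exists Z : 'I_n -> vector_field,
    (forall k, is_holomorphic_vector_field (Z k)) /\
    forall c x, atlas M c -> cimg c x -> forall a b : 'I_n -> R,
      \sum_(k < n) (a k *: Z k c x + b k *: mulI (Z k c x)) = 0 ->
      forall k, a k = 0 /\ b k = 0.

End Parallelizable.

Record complexLieGroup (R : realType) (n : nat) := ComplexLieGroup {
  lie_manifold :> complexManifold R n;
  lmul : lie_manifold -> lie_manifold -> lie_manifold;
  lone : lie_manifold;
  linv : lie_manifold -> lie_manifold;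
  lmulA : forall a b c, lmul a (lmul b c) = lmul (lmul a b) c;
  lmul1 : forall a, lmul lone a = a;
  lmulr1 : forall a, lmul a lone = a;
  lmulV : forall a, lmul (linv a) a = lone;
  lmulVr : forall a, lmul a (linv a) = lone;
  lmul_cont : continuous (fun p : lie_manifold * lie_manifold => lmul p.1 p.2);
  lmul_holo : forall c1 c2 d,
    atlas lie_manifold c1 -> atlas lie_manifold c2 -> atlas lie_manifold d ->
    holomorphic_wrt mulI2 mulI
      [set z | [/\ cimg c1 z.1, cimg c2 z.2
                 & cdom d (lmul (cinv c1 z.1) (cinv c2 z.2))]]
      (fun z => cmap d (lmul (cinv c1 z.1) (cinv c2 z.2)));
  linv_holo : holomorphic_on [set: lie_manifold] linv }.

Section Quotient.
Context {R : realType} {n : nat}.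
Variables (G : complexLieGroup R n) (Gam : set G).

Definition discrete_subgroup :=
  [/\ Gam (@lone _ _ G),
      forall a b, Gam a -> Gam b -> Gam (lmul a b),
      forall a, Gam a -> Gam (linv a)
    & exists U : set G, [/\ open U, U (@lone _ _ G)
        & U `&` Gam `<=` [set @lone _ _ G]]].

(* pi exhibits the complex manifold M as the quotient of G by the left
   translations by elements of Gam: it is onto, its fibers are the orbits, and
   it is locally biholomorphic. *)
Definition is_quotient (M : complexManifold R n) (pi : G -> M) :=
  [/\ forall q, exists p, pi p = q,
      forall p p', pi p = pi p' <-> exists a, Gam a /\ p' = lmul a p,
      holomorphic_on [set: G] pi
    & forall p, exists (U : set G) (s : M -> G),
        [/\ open U, U p, open (pi @` U), holomorphic_on (pi @` U) s
          & forall p', U p' -> s (pi p') = p']].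

End Quotient.

Section Metrics.
Context {R : realType}.

(* The components h c x X Y, in the chart c at x, of a covariant 2-tensor. *)
Definition tensor2 (n : nat) (M : complexManifold R n) :=
  chart R n M -> Cspace R n -> Cspace R n -> Cspace R n -> R.

(* h1 = f^* h2 *)
Definition is_pullback (n m : nat) (M : complexManifold R n)
    (N : complexManifold R m) (f : M -> N) (h1 : tensor2 M) (h2 : tensor2 N) :=
  forall c d, atlas M c -> atlas N d -> forall x, loc_dom f c d x ->
  forall X Y, h1 c x X Y =
    h2 d (loc f c d x) ('D_X (loc f c d) x) ('D_Y (loc f c d) x).

(* A Hermitian metric is represented by its real part, a J-invariant Riemannian
   metric.  metric_glue is the transformation law under changes of charts. *)
Record hermitian_metric (n : nat) (M : complexManifold R n) :=
  HermitianMetric {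
  metric : tensor2 M;
  metric_smooth : forall c X Y, atlas M c ->
    smooth_on (cimg c) (fun x => metric c x X Y);
  metric_linear : forall c x, atlas M c -> cimg c x ->
    forall (a : R) X Y Z,
      metric c x X (a *: Y + Z) = a * metric c x X Y + metric c x X Z;
  metric_sym : forall c x, atlas M c -> cimg c x ->
    forall X Y, metric c x X Y = metric c x Y X;
  metric_pos : forall c x, atlas M c -> cimg c x ->
    forall X, X != 0 -> 0 < metric c x X X;
  metric_J : forall c x, atlas M c -> cimg c x ->
    forall X Y, metric c x (mulI X) (mulI Y) = metric c x X Y;
  metric_glue : is_pullback id metric metric }.

Definition left_invariant (n : nat) (G : complexLieGroup R n)
    (h : hermitian_metric G) :=
  forall a : G, is_pullback (lmul a) (metric h) (metric h).

Definition induced_by_left_invariant (n : nat) (G : complexLieGroup R n)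
    (M : complexManifold R n) (pi : G -> M) (g : hermitian_metric M) :=
  exists h : hermitian_metric G, left_invariant h /\ is_pullback pi (metric h) (metric g).

End Metrics.

Section Connections.
Context {R : realType} {n : nat} (M : complexManifold R n).

(* Christoffel symbols: in the chart c, for constant vector fields X and Y,
   the value at x of nabla_X Y is D c x X Y. *)
Definition christoffel :=
  chart R n M -> Cspace R n -> Cspace R n -> Cspace R n -> Cspace R n.

Definition is_affine_connection (D : christoffel) :=
  [/\ forall c X Y, atlas M c -> smooth_on (cimg c) (fun x => D c x X Y),
      forall c x X, atlas M c -> cimg c x -> linear (D c x X),
      forall c x Y, atlas M c -> cimg c x -> linear (fun X => D c x X Y)
    & forall c d, atlas M c -> atlas M d -> forall x, loc_dom id c d x ->
      forall X Y (tau := loc id c d),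
        'D_(D c x X Y) tau x =
        'D_X (fun z => 'D_Y tau z) x + D d (tau x) ('D_X tau x) ('D_Y tau x)].

(* nabla g = 0 and nabla J = 0 *)
Definition is_hermitian_connection (g : hermitian_metric M) (D : christoffel) :=
  [/\ is_affine_connection D,
      forall c x, atlas M c -> cimg c x -> forall X Y Z,
        'D_X (fun z => metric g c z Y Z) x =
        metric g c x (D c x X Y) Z + metric g c x Y (D c x X Z)
    & forall c x, atlas M c -> cimg c x -> forall X Y,
        D c x X (mulI Y) = mulI (D c x X Y)].

(* Hermitian, with (0,1)-part the Cauchy-Riemann operator of the tangent
   bundle: nabla_{JX} Y = J nabla_X Y for every holomorphic vector field Y, in
   particular for the constant fields of a holomorphic chart. *)
Definition is_chern (g : hermitian_metric M) (D : christoffel) :=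
  is_hermitian_connection g D /\
  forall c x, atlas M c -> cimg c x -> forall X Y,
    D c x (mulI X) Y = mulI (D c x X Y).

Definition torsion (D : christoffel) : christoffel :=
  fun c x X Y => D c x X Y - D c x Y X.

(* Hermitian, with totally skew-symmetric torsion (skew-symmetry in the first
   two arguments holds by construction). *)
Definition is_bismut (g : hermitian_metric M) (D : christoffel) :=
  is_hermitian_connection g D /\
  forall c x, atlas M c -> cimg c x -> forall X Y Z,
    metric g c x (torsion D c x X Y) Z = - metric g c x (torsion D c x X Z) Y.

Definition is_canonical (g : hermitian_metric M) (t : R) (D : christoffel) :=
  exists Dc Db : christoffel,
    [/\ is_chern g Dc, is_bismut g Db
      & forall c x X Y, D c x X Y =
          ((1 + t) / 2) *: Dc c x X Y + ((1 - t) / 2) *: Db c x X Y].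

(* Connection form on the anticanonical bundle, the top complex exterior power
   of the tangent bundle, in the frame s = d_1 /\ .. /\ d_n of a chart:
   nabla_X s is the sum over k of the d_1 /\ .. /\ nabla_X d_k /\ .. /\ d_n. *)
Definition anticanonical_form (D : christoffel) (c : chart R n M)
    (x X : Cspace R n) : R[i] := traceC (D c x X).

(* The curvature of a connection on a line bundle is the exterior derivative
   of its connection form; X and Y are constant fields in the chart. *)
Definition anticanonical_curvature (D : christoffel) (c : chart R n M)
    (x X Y : Cspace R n) : R[i] :=
  ('D_X (fun z => complex.Re (anticanonical_form D c z Y)) x
   - 'D_Y (fun z => complex.Re (anticanonical_form D c z X)) x)
  +i* ('D_X (fun z => complex.Im (anticanonical_form D c z Y)) x
   - 'D_Y (fun z => complex.Im (anticanonical_form D c z X)) x).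

(* For a Hermitian connection the curvature of the anticanonical bundle is
   purely imaginary, so that it equals i times this real 2-form. *)
Definition ricci_form (D : christoffel) : tensor2 M :=
  fun c x X Y => complex.Im (anticanonical_curvature D c x X Y).

Definition ricci_flat (D : christoffel) :=
  forall c x, atlas M c -> cimg c x -> forall X Y, ricci_form D c x X Y = 0.

Definition is_CYT (g : hermitian_metric M) :=
  forall D, is_bismut g D -> ricci_flat D.

End Connections.

(* Main.v *)
(* Near a point x0 of a chart, M inherits from the group law of G a local
   holomorphic group law m with unit x0.  The fields A(.)v = d_2 m(., x0) v form
   a holomorphic frame, which is unitary up to a constant Gram matrix (left
   invariance of the metric) and whose brackets c(u, v) have constant
   coefficients (associativity of m).  In that frame a Hermitian connection has
   constant coefficients b(u) : b = 0 for the Chern connection, and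
   b(u) = ad_u - ad_u^* for the Bismut connection.  Differentiating
   nabla_(A u) (A v) = A (b(u) v) at x0 and taking the imaginary part of the
   complex trace, all commutators disappear and the Ricci form is
   rho(X, Y) = - Im tr b(c(X, Y)).  In the Bismut case this is
   - 2 Im tr ad_(c(X, Y)), which vanishes because, by the Jacobi identity,
   ad_(c(X, Y)) is a commutator.  The form rho^t is an affine combination of the
   two. *)
Require Import Defs.
From HB Require Import structures.
From mathcomp Require Import all_boot all_order all_algebra.
From mathcomp Require Import all_classical all_reals all_analysis.
From mathcomp Require Import complex ring lra.

Set Implicit Arguments.
Unset Strict Implicit.
Unset Printing Implicit Defensive.

Import Order.TTheory GRing.Theory Num.Theory.
Import numFieldNormedType.Exports.

Local Open Scope classical_set_scope.
Local Open Scope ring_scope.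

(** * Smooth maps between normed spaces *)

Section Calculus.
Context {R : realType}.
Implicit Types E F G H : normedModType R.

(** The Ricci form at a point needs only the first derivatives of the Christoffel symbols there, but
    those symbols live in a holomorphic chart and not in an invariant frame. Hence each point [x0]
    of each chart gets its own group law centred at [x0]; frames at different points are never
    compared, and the group identities are asserted only near [x0]. Two facts about traces shape the
    argument. The imaginary trace kills commutators of complex linear maps, so every operator met on
    the way has to be shown to commute with [J]. And the adjoint for a Hermitian inner product
    conjugates the complex trace: this is the origin of the factor 2 when the coefficient is ad
    minus its adjoint. Symmetry of second derivatives is behind the constancy of the brackets, the
    Jacobi identity and the cancellation of the second-order terms of the curvature. The
    coefficients [b] of both connections are found by the same device: a tensor through which [J]
    can be moved along two routes with opposite signs must vanish. *)

Lemma linear_bundle E F (f : E -> F) : linear f -> exists g : {linear E -> F}, f = g.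
Proof.
move=> lf; pose m := GRing.isLinear.Build R E F *:%R f lf.
by pose g : {linear E -> F} := HB.pack f m; exists g.
Qed.

Definition continuous_linear E F (f : E -> F) := linear f /\ continuous f.

Lemma continuous_linear_diff E F (f : E -> F) x :
  continuous_linear f -> differentiable f x.
Proof.
move=> [/linear_bundle[g ->] cg]; exact: linear_differentiable.
Qed.

Lemma continuous_linear_derive E F (f : E -> F) x v :
  continuous_linear f -> 'D_v f x = f v.
Proof.
move=> cf; rewrite deriveE; last exact: continuous_linear_diff.
by case: cf => /linear_bundle[g ->] cg; rewrite diff_lin.
Qed.

Lemma derive_linear E F (f : E -> F) x : differentiable f x ->
  linear (fun v => 'D_v f x).
Proof. by move=> df a u v; rewrite !deriveE// linearP. Qed.

Lemma derive_comp E F G (f : E -> F) (g : F -> G) x v :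
  differentiable f x -> differentiable g (f x) ->
  'D_v (fun z => g (f z)) x = 'D_('D_v f x) g (f x).
Proof.
move=> df dg; rewrite !deriveE//; last exact: differentiable_comp.
by rewrite (@diff_comp _ _ _ _ f g).
Qed.

(** The little-o statement unfolded into bounds. In this form only the values of [f] near [x]
    matter, so differentiability passes to functions that agree with [f] near [x]; uniqueness of the
    differential identifies any such [df] with ['d f x]. *)
Lemma differentiable_eps E F (f : E -> F) x : differentiable f x <->
  exists2 df : {linear E -> F}, continuous df & forall e : R, 0 < e ->
    \forall h \near 0, `|f (h + x) - f x - df h| <= e * `|h|.
Proof.
split=> [dfx|[df cdf H]].
  have /diff_locallyP[c /eqaddoP H] := dfx.
  exists ('d f x) => // e e0; move: (H e e0); apply: filterS => h.
  by rewrite /= !fctE /= opprD addrA.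
have Hdf : f \o shift x = cst (f x) + df +o_ 0 id.
  apply/eqaddoP => e e0; move: (H e e0); apply: filterS => h.
  by rewrite /= !fctE /= opprD addrA.
have E1 := diff_unique cdf Hdf.
by apply/diff_locallyP; rewrite E1.
Qed.

Lemma near_eq_diff E F (f g : E -> F) x :
  (\near x, f x = g x) -> differentiable f x -> differentiable g x.
Proof.
move=> fg /differentiable_eps[df cdf H]; apply/differentiable_eps.
exists df => // e e0; have := H e e0; rewrite -(nbhs_singleton fg).
move: fg; rewrite (near_shift 0) subr0 /= => fg.
by apply: filterS2 fg => h /= <-.
Qed.

Lemma is_derive_bigsum (I : Type) (r : seq I) E F (f : I -> E -> F) x v :
  (forall i, differentiable (f i) x) ->
  differentiable (fun z => \sum_(i <- r) f i z) x /\
  'D_v (fun z => \sum_(i <- r) f i z) x = \sum_(i <- r) 'D_v (f i) x.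
Proof.
move=> df; elim: r => [|i r [d1 d2]].
  under eq_fun do rewrite big_nil.
  by rewrite big_nil; split; [exact: differentiable_cst|exact: derive_cst].
under eq_fun do rewrite big_cons.
rewrite big_cons; split; first exact: differentiableD.
by rewrite deriveD ?d2//; exact: diff_derivable.
Qed.

(* A finite spanning family with continuous coordinate functions, which need not
   be linearly independent. *)
Definition finite_coordinates E := exists (I : finType) (e : I -> E) (l : I -> E -> R),
  (forall i, continuous_linear (l i)) /\ forall X, X = \sum_i l i X *: e i.

Lemma scale_bilinear F :
  bilinear_for (GRing.Scale.Law.clone _ _ *:%R _) (GRing.Scale.Law.clone _ _ *:%R _)
    (fun (k : R) (u : F) => k *: u).
Proof.
split=> [u'|u] a x y /=.
- by rewrite scalerDl scalerA.
- by rewrite scalerDr !scalerA mulrC.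
Qed.

(** Scaling is a continuous bilinear map, so both claims are the chain rule through it, applied to
    the pair [(k, f)]. *)
Lemma is_deriveZf E F (k : E -> R) (f : E -> F) x v :
  differentiable k x -> differentiable f x ->
  differentiable (fun z => k z *: f z) x /\
  'D_v (fun z => k z *: f z) x = 'D_v k x *: f x + k x *: 'D_v f x.
Proof.
move=> dk df.
pose m := bilinear_isBilinear.Build R R F F _ _ _ (@scale_bilinear F).
pose g : {bilinear R -> F -> F} := HB.pack (fun (k : R) (u : F) => k *: u) m.
have cg : continuous (fun p : R * F => g p.1 p.2) by apply: scale_continuous.
have dp : differentiable (fun z => (k z, f z)) x by exact: differentiable_pair.
have dg := differentiable_bilin (k x, f x) cg.
have d : differentiable (fun z => k z *: f z) x.
  exact: (differentiable_comp dp dg).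
split=> //; rewrite (derive_comp (g := fun p => g p.1 p.2) v dp dg).
by rewrite !deriveE// diff_pair// diff_bilin//= addrC.
Qed.

Lemma finite_coordinates_continuous E F (f : E -> F) : finite_coordinates E -> linear f ->
  continuous_linear f.
Proof.
move=> [I [e [l [lc eE]]]] lf; split=> //.
have -> : f = fun x => \sum_i l i x *: f (e i).
  apply/funext => x; rewrite [in LHS](eE x); case: (linear_bundle lf) => g ->.
  by rewrite linear_sum; apply: eq_bigr => i _; rewrite linearZ.
move=> x; apply: differentiable_continuous.
apply: (is_derive_bigsum _ 0 _).1 => i; apply: differentiableZl.
exact: continuous_linear_diff.
Qed.

(** Testing a vector identity on linear functionals turns it into an identity of real numbers, which
    [ring] can settle. *)
Lemma finite_coordinates_ext E (X Y : E) : finite_coordinates E ->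
  (forall l : {linear E -> R}, l X = l Y) -> X = Y.
Proof.
move=> [I [e [l [lc eE]]]] XY; rewrite (eE X) (eE Y); apply: eq_bigr => i _.
by have [g ->] := linear_bundle (lc i).1; rewrite XY.
Qed.

Lemma finite_coordinates_rV n : finite_coordinates 'rV[R]_n.
Proof.
exists 'I_n, (fun i => delta_mx 0 i), (fun i (X : 'rV[R]_n) => X 0 i).
split=> [i|X]; last exact: row_sum_delta.
split; first by move=> a u v; rewrite !mxE.
by move=> x; apply: differentiable_continuous; exact: differentiable_coord.
Qed.

Lemma finite_coordinates_prod E F : finite_coordinates E -> finite_coordinates F ->
  finite_coordinates (E * F)%type.
Proof.
move=> [I [e [l [lc eE]]]] [J [e' [l' [lc' eE']]]].
exists (I + J)%type, (fun k => match k with inl i => (e i, 0) | inr j => (0, e' j) end),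
  (fun k X => match k with inl i => l i X.1 | inr j => l' j X.2 end).
split=> [[i|j]|[x y]].
- split; first by move=> a u v /=; rewrite (lc i).1.
  by move=> [x y]; apply: (cvg_comp _ _ cvg_fst); exact: (lc i).2.
- split; first by move=> a u v /=; rewrite (lc' j).1.
  by move=> [x y]; apply: (cvg_comp _ _ cvg_snd); exact: (lc' j).2.
rewrite big_sumType /= [X in (X, _)]eE [X in (_, X)]eE'.
have -> : \sum_i l i x *: (e i, 0 : F) = (\sum_i l i x *: e i, 0).
  by elim/big_rec2: _ => // i a b _ ->; congr (_, _); rewrite /= scaler0 addr0.
have -> : \sum_i l' i y *: (0 : E, e' i) = (0, \sum_i l' i y *: e' i).
  by elim/big_rec2: _ => // i a b _ ->; congr (_, _); rewrite /= scaler0 addr0.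
by congr (_, _); rewrite /= ?addr0 ?add0r.
Qed.

Lemma finite_coordinates_Cspace n : finite_coordinates (Cspace R n).
Proof. exact: finite_coordinates_prod (finite_coordinates_rV n) (finite_coordinates_rV n). Qed.

(* [smooth_on] truncated at order [k], to make inductions on the order possible. *)
Fixpoint smooth_upto (k : nat) E F (U : set E) (f : E -> F) : Prop :=
  (forall x, U x -> differentiable f x) /\
  if k is k'.+1 then forall v, smooth_upto k' U (fun x => 'D_v f x) else True.

Lemma smooth_onP E F (U : set E) (f : E -> F) :
  smooth_on U f <-> forall k, smooth_upto k U f.
Proof.
split=> [sf k|sf vs].
  elim: k f sf => [|k IH] f sf; first by split=> // x; exact: (sf [::]).
  split=> [x|v]; first exact: (sf [::]).
  by apply: IH => vs; exact: (sf (v :: vs)).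
elim: vs f sf => [|v vs IH] f sf x Ux; first exact: (sf 0%N).1.
by apply: IH => // k; exact: (sf k.+1).2.
Qed.

Lemma smooth_upto_diff k E F (U : set E) (f : E -> F) x :
  smooth_upto k U f -> U x -> differentiable f x.
Proof. by case: k => [|k] [df _] /df. Qed.

Lemma smooth_uptoS k E F (U : set E) (f : E -> F) :
  smooth_upto k.+1 U f -> smooth_upto k U f.
Proof.
elim: k f => [|k IH] f [df sf]; split=> // v; exact/IH/sf.
Qed.

Lemma smooth_upto_eq k E F (U : set E) (f g : E -> F) : open U ->
  (forall x, U x -> f x = g x) -> smooth_upto k U f -> smooth_upto k U g.
Proof.
move=> oU; elim: k f g => [|k IH] f g fg [df sf];
  have dg x : U x -> {near x, f =1 g} /\ differentiable g x by (move=> Ux;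
    have fgx : {near x, f =1 g} by [apply: filterS (open_nbhs_nbhs (conj oU Ux)); exact: fg];
    split=> //; exact: near_eq_diff fgx (df x Ux)).
  by split=> // x /dg[].
split=> // [x /dg[]//|v]; apply: IH (sf v) => x /dg[fgx _]; exact: near_eq_derive fgx.
Qed.

Lemma smooth_upto_sum k (I : Type) (r : seq I) E F (U : set E) (f : I -> E -> F) :
  open U -> (forall i, smooth_upto k U (f i)) ->
  smooth_upto k U (fun x => \sum_(i <- r) f i x).
Proof.
move=> oU; elim: k f => [|k IH] f sf.
  by split=> // x Ux; apply: (is_derive_bigsum r 0 _).1 => i; exact: (sf i).1.
split=> [x Ux|v]; first by apply: (is_derive_bigsum r 0 _).1 => i; exact: (sf i).1.
apply: (smooth_upto_eq oU _ (IH _ (fun i => (sf i).2 v))) => x Ux.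
by rewrite (is_derive_bigsum r v _).2// => i; exact: (sf i).1.
Qed.

Lemma smooth_uptoD k E F (U : set E) (f g : E -> F) : open U ->
  smooth_upto k U f -> smooth_upto k U g -> smooth_upto k U (fun x => f x + g x).
Proof.
move=> oU sf sg.
have := @smooth_upto_sum k bool [:: true; false] E F U (fun b => if b then f else g) oU.
move=> /(_ (fun b => if b as b return smooth_upto k U (if b then f else g) then sf else sg)).
by apply: smooth_upto_eq => // x Ux; rewrite !big_cons big_nil addr0.
Qed.

Lemma smooth_uptoZ k E F (U : set E) (a : E -> R) (f : E -> F) : open U ->
  smooth_upto k U a -> smooth_upto k U f -> smooth_upto k U (fun x => a x *: f x).
Proof.
move=> oU; elim: k a f => [|k IH] a f sa sf.
  by split=> // x Ux; apply: (is_deriveZf 0 (sa.1 _ _) (sf.1 _ _)).1.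
split=> [x Ux|v]; first by apply: (is_deriveZf 0 (sa.1 _ _) (sf.1 _ _)).1.
apply: (smooth_upto_eq oU _ (smooth_uptoD oU (IH _ _ (sa.2 v) (smooth_uptoS sf))
   (IH _ _ (smooth_uptoS sa) (sf.2 v)))) => x Ux /=.
by rewrite (is_deriveZf v (sa.1 _ Ux) (sf.1 _ Ux)).2.
Qed.

Lemma smooth_upto_lin k E F G (U : set E) (f : E -> F) (l : F -> G) : open U ->
  continuous_linear l -> smooth_upto k U f -> smooth_upto k U (fun x => l (f x)).
Proof.
move=> oU cl; elim: k f => [|k IH] f [df sf];
  have dlf x : U x -> differentiable (fun x => l (f x)) x
    by (move=> /df dfx; exact: (differentiable_comp dfx (continuous_linear_diff _ cl))).
  by split.
split=> // v; apply: (smooth_upto_eq oU _ (IH _ (sf v))) => x Ux /=.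
have dl := continuous_linear_diff (f x) cl; have dfx := df x Ux.
by rewrite (derive_comp v dfx dl) (continuous_linear_derive _ _ cl).
Qed.

(** The chain rule gives ['D_('D_v f x) g (f x)], whose direction moves with [x], out of reach of
    the induction hypothesis. Expanding the direction in coordinates of [F] leaves fixed directions
    [e i] with scalar coefficients, that is, a sum of products of functions smooth up to order
    [k]. *)
Lemma smooth_upto_comp k E F G (U : set E) (V : set F) (f : E -> F) (g : F -> G) :
  finite_coordinates F -> open U -> (forall x, U x -> V (f x)) ->
  smooth_upto k U f -> smooth_upto k V g -> smooth_upto k U (fun x => g (f x)).
Proof.
move=> [I [e [l [lc eE]]]] oU fUV.
elim: k f g fUV => [|k IH] f g fUV sf sg;
  have dgf x : U x -> differentiable (fun x => g (f x)) x
    by (move=> Ux; exact: (differentiable_comp (smooth_upto_diff sf Ux)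
            (smooth_upto_diff sg (fUV x Ux)))).
  by split.
split=> // v; apply: (smooth_upto_eq (f := fun x => \sum_i l i ('D_v f x) *: 'D_(e i) g (f x))) => //.
  move=> x Ux.
  have dg := smooth_upto_diff sg (fUV x Ux).
  case: (linear_bundle (derive_linear dg)) => L LE.
  have LEv w : 'D_w g (f x) = L w by rewrite -LE.
  rewrite (derive_comp v (smooth_upto_diff sf Ux) dg) [in RHS](eE ('D_v f x)).
  by rewrite LEv linear_sum; apply: eq_bigr => i _; rewrite linearZ LEv.
apply: smooth_upto_sum => // i; apply: smooth_uptoZ => //.
  by apply: smooth_upto_lin => //; exact: sf.2.
by apply: IH (smooth_uptoS sf) (sg.2 _).
Qed.

End Calculus.

(** * Leibniz rule for families of linear maps, and symmetry of second derivatives *)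

Section Calculus2.
Context {R : realType}.
Implicit Types E F G H : normedModType R.

(** Leibniz rule for a moving linear map applied to a moving vector. Only the maps [z |-> L z w]
    with [w] fixed are assumed differentiable; coordinates on [F] reduce [L z (a z)] to finitely
    many of them. *)
Lemma derive_linear_family E F G (L : E -> F -> G) (a : E -> F) x v :
  finite_coordinates F -> (\forall z \near x, linear (L z)) ->
  (forall w, differentiable (fun z => L z w) x) -> differentiable a x ->
  differentiable (fun z => L z (a z)) x /\
  'D_v (fun z => L z (a z)) x = 'D_v (fun z => L z (a x)) x + L x ('D_v a x).
Proof.
move=> [I [e [l [lc eE]]]] linL dL.
(* The sum in [H] depends on [b] only through [b x]; applying [H] to the constant [a x] identifies
   it with the derivative of [L z (a x)]. *)
suff H b : differentiable b x -> differentiable (fun z => L z (b z)) x /\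
    'D_v (fun z => L z (b z)) x =
      \sum_i l i (b x) *: 'D_v (fun z => L z (e i)) x + L x ('D_v b x).
  move=> da; split; first exact: (H a da).1.
  rewrite (H a da).2 (H (cst (a x)) (differentiable_cst _ _)).2.
  case: (linear_bundle (nbhs_singleton linL)) => g gE.
  by rewrite derive_cst gE linear0 addr0.
move=> db.
have Hn : {near x, (fun z => \sum_i l i (b z) *: L z (e i)) =1 (fun z => L z (b z))}.
  apply: filterS linL => z /linear_bundle[g gE]; rewrite gE [in RHS](eE (b z)) linear_sum.
  by apply: eq_bigr => i _; rewrite linearZ.
have dlb i : differentiable (fun z => l i (b z)) x.
  exact: (differentiable_comp db (continuous_linear_diff _ (lc i))).
have dZ i := is_deriveZf v (dlb i) (dL (e i)).
have [S1 S2] := is_derive_bigsum (index_enum I) v (fun i => (dZ i).1).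
split; first exact: near_eq_diff Hn S1.
rewrite -(near_eq_derive v Hn) S2.
case: (linear_bundle (nbhs_singleton linL)) => g gE.
rewrite [in X in _ + X](eE ('D_v b x)) gE linear_sum -big_split; apply: eq_bigr => i _ /=.
rewrite (dZ i).2 (derive_comp v db (continuous_linear_diff _ (lc i))).
by rewrite (continuous_linear_derive _ _ (lc i)) addrC linearZ -gE.
Qed.

Lemma smooth_upto_cst k E F (U : set E) (a : F) : open U -> smooth_upto k U (cst a).
Proof.
move=> oU; elim: k a => [|k IH] a; first by split=> // x _; exact: differentiable_cst.
split=> [x _|v]; first exact: differentiable_cst.
by apply: smooth_upto_eq (IH 0) => // x _; rewrite derive_cst.
Qed.

Lemma smooth_on_cst E F (U : set E) (a : F) : open U -> smooth_on U (cst a).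
Proof. by move=> oU; apply/smooth_onP => k; exact: smooth_upto_cst. Qed.

Lemma smooth_on_linear E F (U : set E) (f : E -> F) : open U ->
  continuous_linear f -> smooth_on U f.
Proof.
move=> oU cl; apply/smooth_onP => -[|k].
  by split=> // x _; exact: continuous_linear_diff.
split=> [x _|v]; first exact: continuous_linear_diff.
by apply: smooth_upto_eq (smooth_upto_cst k (f v) oU) => // x _; rewrite continuous_linear_derive.
Qed.

Lemma smooth_on_eq E F (U : set E) (f g : E -> F) : open U ->
  (forall x, U x -> f x = g x) -> smooth_on U f -> smooth_on U g.
Proof. by move=> oU fg /smooth_onP sf; apply/smooth_onP => k; exact: smooth_upto_eq (sf k). Qed.

Lemma smooth_on_sub E F (U V : set E) (f : E -> F) :
  V `<=` U -> smooth_on U f -> smooth_on V f.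
Proof. by move=> VU sf vs x /VU; exact: sf. Qed.

Lemma smooth_on_derive E F (U : set E) (f : E -> F) v :
  smooth_on U f -> smooth_on U (fun x => 'D_v f x).
Proof. by move=> sf vs; exact: (sf (v :: vs)). Qed.

Lemma smooth_on_diff E F (U : set E) (f : E -> F) x :
  smooth_on U f -> U x -> differentiable f x.
Proof. by move=> sf; exact: (sf [::]). Qed.

Lemma smooth_on_comp E F G (U : set E) (V : set F) (f : E -> F) (g : F -> G) :
  finite_coordinates F -> open U -> (forall x, U x -> V (f x)) ->
  smooth_on U f -> smooth_on V g -> smooth_on U (fun x => g (f x)).
Proof.
move=> cF oU fUV /smooth_onP sf /smooth_onP sg; apply/smooth_onP => k.
exact: smooth_upto_comp (sf k) (sg k).
Qed.

Lemma continuous_linear_pairl E F : continuous_linear (fun x : E => (x, 0 : F)).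
Proof.
split; first by move=> a u v; congr (_, _); rewrite /= scaler0 addr0.
by move=> x; apply: cvg_pair => //; exact: cvg_cst.
Qed.

Lemma continuous_linear_pairr E F : continuous_linear (fun x : F => (0 : E, x)).
Proof.
split; first by move=> a u v; congr (_, _); rewrite /= scaler0 addr0.
by move=> x; apply: cvg_pair => //; exact: cvg_cst.
Qed.

Lemma continuous_linear_fst E F : continuous_linear (fun x : E * F => x.1).
Proof. by split=> // x; exact: cvg_fst. Qed.

Lemma continuous_linear_snd E F : continuous_linear (fun x : E * F => x.2).
Proof. by split=> // x; exact: cvg_snd. Qed.

Lemma smooth_on_pair E F G (U : set E) (f : E -> F) (g : E -> G) : open U ->
  smooth_on U f -> smooth_on U g -> smooth_on U (fun x => (f x, g x)).
Proof.
move=> oU /smooth_onP sf /smooth_onP sg; apply/smooth_onP => k.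
apply: (smooth_upto_eq oU _ (smooth_uptoD oU
  (smooth_upto_lin oU (continuous_linear_pairl F G) (sf k))
  (smooth_upto_lin oU (continuous_linear_pairr F G) (sg k)))) => x Ux.
by congr (_, _); rewrite /= ?addr0 ?add0r.
Qed.

(* The mean value theorem along [u]; the second difference being symmetric in [u] and
   [v], both mixed derivatives are its limit. *)
Lemma second_difference E (f : E -> R) x u v (e : R) : 0 < e ->
  (\forall z \near x, differentiable f z) -> differentiable (fun z => 'D_u f z) x ->
  \forall t \near (0 : R)^'+,
    `|f (t *: u + (t *: v + x)) - f (t *: u + x) - (f (t *: v + x) - f x)
       - t ^+ 2 * 'D_v (fun z => 'D_u f z) x| <= e * t ^+ 2.
Proof.
move=> e0 df du.
have [d dvE Hd] : exists2 d : {linear E -> R}, 'D_v (fun z => 'D_u f z) x = d v &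
    forall e : R, 0 < e ->
    \forall h \near 0, `|'D_u f (h + x) - 'D_u f x - d h| <= e * `|h|.
  exists ('d (fun z => 'D_u f z) x); first by rewrite deriveE.
  have /diff_locallyP[_ /eqaddoP H] := du.
  move=> e' e'0; move: (H e' e'0); apply: filterS => h.
  by rewrite /= !fctE /= opprD addrA.
(* At the intermediate point the two displacements have norms at most [t (|u| + |v|)] and [t |u|];
   their sum fixes [N], and the 1 keeps it positive. *)
set N := 2 * `|u| + `|v| + 1.
have N0 : 0 < N by rewrite ltr_wpDl// addr_ge0// mulr_ge0.
have [r /= r0 Hr] : exists2 r, 0 < r & forall h : E, `|h| < r ->
   differentiable f (h + x) /\ `|'D_u f (h + x) - 'D_u f x - d h| <= e / N * `|h|.
  move: df; rewrite (near_shift 0) subr0 => df.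
  have /nbhs_normP[r /= r0 Hr] : \forall h \near (0 : E), differentiable f (h + x) /\
      `|'D_u f (h + x) - 'D_u f x - d h| <= e / N * `|h|.
    by apply: filterI; [exact: df|exact: Hd (divr_gt0 e0 N0)].
  by exists r => // h hr; apply: Hr; rewrite /= sub0r normrN.
near=> t.
have t0 : 0 < t by near: t; exact: nbhs_right_gt.
have tr : t * N < r.
  rewrite -ltr_pdivlMr//; near: t; apply: nbhs_right_lt; exact: divr_gt0.
have small s w : 0 <= s <= t -> `|w| <= t * `|v| -> `|s *: u + w| < r.
  move=> /andP[s0 st] wv; apply: le_lt_trans tr; apply: le_trans (ler_normD _ _) _.
  rewrite normrZ (ger0_norm s0) /N.
  have : s * `|u| <= t * `|u| by rewrite ler_wpM2r.
  have : 0 <= t * `|u| by rewrite mulr_ge0// ltW.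
  have := ltW t0; lra.
have wv0 : `|0 : E| <= t * `|v| by rewrite normr0 mulr_ge0// ltW.
have wv1 : `|t *: v| <= t * `|v| by rewrite normrZ gtr0_norm.
have line s w : 0 <= s <= t -> `|w| <= t * `|v| ->
    is_derive s (1 : R) (fun s : R => f (s *: u + (w + x))) ('D_u f (s *: u + (w + x))).
  move=> st wv; have [df' _] := Hr _ (small _ _ st wv); rewrite -addrA in df'.
  have da : differentiable (fun s : R => s *: u + (w + x)) s.
    by apply: differentiableD => //; exact: differentiableZl.
  apply: DeriveDef; first by apply/diff_derivable; exact: (differentiable_comp da df').
  have cl : continuous_linear (fun s : R => s *: u).
    split; first by move=> a b c; rewrite scalerDl scalerA.
    by move=> z; apply: differentiable_continuous; exact: differentiableZl.
  rewrite (derive_comp (g := f) _ da df') deriveD; last 2 first.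
  - exact/diff_derivable/continuous_linear_diff.
  - exact: derivable_cst.
  by rewrite (continuous_linear_derive s (1 : R) cl) (derive_cst (w + x) s (1 : R)) addr0 scale1r.
pose phi s := f (s *: u + (t *: v + x)) - f (s *: u + (0 + x)).
have dphi s : 0 <= s <= t -> is_derive s (1 : R) phi
    ('D_u f (s *: u + (t *: v + x)) - 'D_u f (s *: u + (0 + x))).
  by move=> st; apply: is_deriveB; exact: line.
have [||c ct] := MVT (f := phi)
  (df := fun s => 'D_u f (s *: u + (t *: v + x)) - 'D_u f (s *: u + (0 + x))) t0.
- by move=> s; rewrite in_itv /= => /andP[s0 st]; apply: dphi; rewrite !ltW.
- apply: derivable_within_continuous => s; rewrite in_itv /= => st.
  by have [] := dphi s st.
have ct' : 0 <= c <= t by move: ct; rewrite in_itv /= => /andP[s0 st]; rewrite !ltW.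
rewrite /phi !scale0r !add0r => ->.
have [_ h1] := Hr _ (small _ _ ct' wv1).
have [_ h2] := Hr _ (small _ _ ct' wv0).
move: h1 h2; rewrite -(addrA _ (t *: v)) -(addrA _ 0) add0r dvE => h1 h2.
have wc w : `|w| <= t * `|v| -> `|c *: u + w| <= t * (`|u| + `|v|).
  move=> wv; apply: le_trans (ler_normD _ _) _; rewrite mulrDr lerD//.
  by case/andP: ct' => c0 ct1; rewrite normrZ ger0_norm// ler_wpM2r.
have eN := divr_gt0 e0 N0.
have {}h1 := le_trans h1 (ler_wpM2l (ltW eN) (wc _ wv1)).
have {}h2 := le_trans h2 (ler_wpM2l (ltW eN) (_ : `|c *: u + 0| <= t * `|u|)).
have {h2}/h2 : `|c *: u + 0| <= t * `|u|.
  by case/andP: ct' => c0 ct1; rewrite addr0 normrZ ger0_norm// ler_wpM2r.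
have dE w s : d (c *: u + s *: w) = c * d u + s * d w by rewrite linearD !linearZ.
move: h1; rewrite dE -{1}(scale0r v) dE.
move: ('D_u f (c *: u + _)) ('D_u f (c *: u + _)) ('D_u f x) (d u) (d v) => Q P Z du' dv' h1 h2.
have -> : (P - Q) * (t - 0) - t ^+ 2 * dv' =
    (P - Z - (c * du' + t * dv') - (Q - Z - (c * du' + 0 * dv'))) * t.
  by ring.
rewrite normrM (gtr0_norm t0) expr2 mulrA ler_pM2r//.
apply: le_trans (ler_normB _ _) _; apply: le_trans (lerD h1 h2) _.
rewrite -mulrDr -mulrDr mulrAC ler_pdivrMr// -!mulrA ler_pM2l// ler_pM2l//.
rewrite /N; lra.
Unshelve. all: by end_near. Qed.

Lemma derive_swap_real E (f : E -> R) x u v :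
  (\forall z \near x, differentiable f z) ->
  differentiable (fun z => 'D_u f z) x -> differentiable (fun z => 'D_v f z) x ->
  'D_v (fun z => 'D_u f z) x = 'D_u (fun z => 'D_v f z) x.
Proof.
move=> df du dv; apply/eqP; rewrite -subr_eq0 -normr_le0; apply/ler_addgt0Pl => e e0.
have e20 : 0 < e / 2 by rewrite divr_gt0.
have D1 := second_difference v e20 df du; have D2 := second_difference u e20 df dv.
have [t [[H1 H2] t0]] := filter_ex (filterI (filterI D1 D2) (nbhs_right_gt 0)).
have t2 : 0 < t ^+ 2 by rewrite exprn_gt0.
rewrite addr0 -(ler_pM2r t2); move: H1 H2.
rewrite (addrCA (t *: v) (t *: u)).
move: (f (t *: u + _)) (f (t *: v + x)) (f (t *: u + x)) (f x) ('D_v _ x) ('D_u _ x).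
move: (t ^+ 2) t2 => s s0 a b c d X Y {D1 D2 df du dv}.
have <- : `|(X - Y) * s| = `|X - Y| * s by rewrite normrM (ger0_norm (ltW s0)).
rewrite !ler_norml => /andP[h1 h2] /andP[h3 h4].
by apply/andP; split; lra.
Qed.

Lemma derive_swap E F (f : E -> F) x u v : finite_coordinates F ->
  (\forall z \near x, differentiable f z) ->
  differentiable (fun z => 'D_u f z) x -> differentiable (fun z => 'D_v f z) x ->
  'D_v (fun z => 'D_u f z) x = 'D_u (fun z => 'D_v f z) x.
Proof.
move=> [I [e [l [lc eE]]]] df du dv.
have ext (X Y : F) : (forall i, l i X = l i Y) -> X = Y.
  by move=> H; rewrite (eE X) (eE Y); apply: eq_bigr => i _; rewrite H.
apply: ext => i.
have dl z := continuous_linear_diff z (lc i).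
have lD w z : differentiable f z -> l i ('D_w f z) = 'D_w (fun z => l i (f z)) z.
  by move=> dfz; rewrite (derive_comp w dfz (dl _)) (continuous_linear_derive _ _ (lc i)).
have lDn w : {near x, (fun z => l i ('D_w f z)) =1 (fun z => 'D_w (fun z => l i (f z)) z)}.
  by apply: filterS df => z; exact: lD.
have lDD w w' : differentiable (fun z => 'D_w f z) x ->
  l i ('D_w' (fun z => 'D_w f z) x) = 'D_w' (fun z => 'D_w (fun z => l i (f z)) z) x.
  move=> dw; rewrite -(near_eq_derive w' (lDn w)) (derive_comp w' dw (dl _)).
  by rewrite (continuous_linear_derive _ _ (lc i)).
rewrite (lDD u v du) (lDD v u dv).
apply: (@derive_swap_real E (fun z => l i (f z)) x u v).
- by apply: filterS df => z dfz; exact: (differentiable_comp dfz (dl _)).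
- by apply: near_eq_diff (lDn u) _; exact: (differentiable_comp du (dl _)).
- by apply: near_eq_diff (lDn v) _; exact: (differentiable_comp dv (dl _)).
Qed.
End Calculus2.

(** * Traces of complex linear maps *)

Section Traces.
Context {R : realType} {n : nat}.
Local Notation E := (Cspace R n).
Implicit Types (f g : E -> E) (X Y : E).

Definition real_row X : 'rV[R]_(n + n) := row_mx X.1 X.2.
Definition of_real_row (v : 'rV[R]_(n + n)) : E := (lsubmx v, rsubmx v).

Lemma real_rowK : cancel real_row of_real_row.
Proof. by move=> [x y]; rewrite /of_real_row row_mxKl row_mxKr. Qed.

Lemma of_real_rowK : cancel of_real_row real_row.
Proof. by move=> v; rewrite /real_row hsubmxK. Qed.

Lemma real_row_linear : linear real_row.
Proof.
by move=> a [x1 x2] [y1 y2]; rewrite /real_row /= scale_row_mx add_row_mx.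
Qed.

Lemma of_real_row_linear : linear of_real_row.
Proof. by move=> a u v; rewrite /of_real_row !linearP. Qed.

Definition real_mx f : 'M[R]_(n + n) :=
  \matrix_(i, j) real_row (f (of_real_row (delta_mx 0 i))) 0 j.

Lemma real_mxE f X : linear f -> real_row (f X) = real_row X *m real_mx f.
Proof.
move=> lf; have [h hE] : exists h : {linear 'rV[R]_(n + n) -> 'rV[R]_(n + n)},
    (fun v => real_row (f (of_real_row v))) = h.
  apply: (@linear_bundle R 'rV[R]_(n + n) 'rV[R]_(n + n)) => a u v.
  by rewrite of_real_row_linear lf real_row_linear.
have -> : real_row (f X) = h (real_row X) by rewrite -hE real_rowK.
rewrite [in LHS](row_sum_delta (real_row X)) linear_sum; apply/rowP => j.
rewrite summxE mxE; apply: eq_bigr => i _.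
by rewrite linearZ -hE [LHS]mxE; congr (_ * _); rewrite [RHS]mxE.
Qed.

Lemma real_row_inj_mx (A B : 'M[R]_(n + n)) :
  (forall X, real_row X *m A = real_row X *m B) -> A = B.
Proof.
move=> H; apply/row_matrixP => i; rewrite !rowE.
by have := H (of_real_row (delta_mx 0 i)); rewrite of_real_rowK.
Qed.

Lemma real_mx_comp f g : linear f -> linear g ->
  real_mx (fun X => f (g X)) = real_mx g *m real_mx f.
Proof.
move=> lf lg; apply: real_row_inj_mx => X.
rewrite mulmxA -!real_mxE// => a u v; by rewrite lg lf.
Qed.

Lemma mulI_linear : linear (@mulI R n).
Proof.
by move=> a [x1 x2] [y1 y2]; congr (_, _); rewrite /= opprD scalerN.
Qed.

Lemma mulIK X : mulI (mulI X) = - X.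
Proof. by case: X. Qed.

(** The imaginary part of [traceC f] as a sum of real numbers, which keeps the curvature computation
    over [R]. *)
Definition imtr f : R := \sum_(k < n) (f (basisC k)).2 0 k.

(** The real trace of a complex linear map is twice the real part of its complex trace. Applied to
    [f] composed with [mulI], this gives the imaginary part, because Re(iz) = - Im z. *)
Lemma imtrE f : linear f -> (forall X, f (mulI X) = mulI (f X)) ->
  imtr f = - 2^-1 * \tr (real_mx f *m real_mx mulI).
Proof.
move=> lf fJ; rewrite -(real_mx_comp mulI_linear lf) /mxtrace big_split_ord /=.
have b1 k : of_real_row (delta_mx 0 (lshift n k)) = basisC k.
  by apply: (can_inj real_rowK); rewrite of_real_rowK /real_row /= delta_mx_lshift.
have b2 k : of_real_row (delta_mx 0 (rshift n k)) = mulI (basisC k).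
  by apply: (can_inj real_rowK); rewrite of_real_rowK /real_row /= oppr0 delta_mx_rshift.
under eq_bigr do rewrite mxE b1 row_mxEl mxE.
under [X in _ + X]eq_bigr do rewrite mxE b2 row_mxEr fJ mulIK mxE.
by rewrite !sumrN /imtr; field.
Qed.

(** Cyclicity of the real trace, once the matrix of [mulI] has been moved past that of [g], with
    which it commutes. *)
Lemma imtr_mulC f g : linear f -> (forall X, f (mulI X) = mulI (f X)) ->
  linear g -> (forall X, g (mulI X) = mulI (g X)) ->
  imtr (fun X => f (g X)) = imtr (fun X => g (f X)).
Proof.
move=> lf fJ lg local_metric_J.
have lfg : linear (fun X => f (g X)) by move=> a u v; rewrite lg lf.
have lgf : linear (fun X => g (f X)) by move=> a u v; rewrite lf lg.
rewrite !imtrE// => [|X|X]; rewrite ?local_metric_J ?fJ ?local_metric_J//.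
rewrite (real_mx_comp lf lg) (real_mx_comp lg lf); congr (_ * _).
have gJm : real_mx g *m real_mx mulI = real_mx mulI *m real_mx g.
  rewrite -(real_mx_comp mulI_linear lg) -(real_mx_comp lg mulI_linear).
  by congr real_mx; apply/funext.
by rewrite -[in LHS]mulmxA mxtrace_mulC -[in RHS]mulmxA gJm mulmxA.
Qed.

(** The last hypothesis says that [b] is [f] minus its adjoint for [B]. As [mulI] is skew for [B],
    composing with [mulI] gives the adjoint a trace opposite to that of [f], so both parts of [b]
    contribute equally. *)
Lemma imtr_skew_part (B : E -> E -> R) f b :
  (forall X, linear (B X)) -> (forall X Y, B X Y = B Y X) ->
  (forall X, X != 0 -> 0 < B X X) -> (forall X Y, B (mulI X) (mulI Y) = B X Y) ->
  linear f -> (forall X, f (mulI X) = mulI (f X)) ->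
  linear b -> (forall X, b (mulI X) = mulI (b X)) ->
  (forall X Y, B (b X) Y = B (f X) Y - B (f Y) X) -> imtr b = 2 * imtr f.
Proof.
move=> linB symB posB JB lf fJ lb bJ H.
(* The Gram matrix of [B]: the adjoint of [f] has matrix [S (real_mx f)^T S^-1]. *)
pose S := \matrix_(i, j) B (of_real_row (delta_mx 0 i)) (of_real_row (delta_mx 0 j)).
have SE X Y : B X Y = (real_row X *m S *m (real_row Y)^T) 0 0.
  have bil : exists g : {linear 'rV[R]_(n + n) -> R}, (fun v => B X (of_real_row v)) = g.
    apply: (@linear_bundle R 'rV[R]_(n + n) R) => a u v.
    by rewrite of_real_row_linear linB.
  have [g gE] := bil.
  have -> : B X Y = g (real_row Y) by rewrite -gE real_rowK.
  rewrite [in LHS](row_sum_delta (real_row Y)) linear_sum [RHS]mxE; apply: eq_bigr => j _.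
  rewrite linearZ -gE [RHS]mulrC; congr (_ * _); first by rewrite [RHS]mxE.
  have [h hE] : exists h : {linear 'rV[R]_(n + n) -> R},
      (fun v => B (of_real_row v) (of_real_row (delta_mx 0 j))) = h.
    apply: (@linear_bundle R 'rV[R]_(n + n) R) => a u v.
    by rewrite !(symB _ (of_real_row (delta_mx 0 j))) of_real_row_linear linB.
  have -> : B X (of_real_row (delta_mx 0 j)) = h (real_row X) by rewrite -hE real_rowK.
  rewrite [in LHS](row_sum_delta (real_row X)) linear_sum [RHS]mxE; apply: eq_bigr => i _.
  by rewrite linearZ -hE /=; congr (_ * _); rewrite [RHS]mxE.
have BN X Y : B X (- Y) = - B X Y.
  by have [g ->] := linear_bundle (linB X : linear (B X : E -> R)); rewrite linearN.
have JB' X Y : B (mulI X) Y = - B X (mulI Y).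
  by rewrite -[in RHS]JB mulIK BN opprK.
have mxP (P Q : 'M[R]_(n + n)) : (forall X Y, (real_row X *m P *m (real_row Y)^T) 0 0 =
   (real_row X *m Q *m (real_row Y)^T) 0 0) -> P = Q.
  move=> PQ; apply/matrixP => i j.
  have mE (A : 'M[R]_(n + n)) : A i j =
      ((delta_mx 0 i : 'rV_(n + n)) *m A *m (delta_mx 0 j : 'rV_(n + n))^T) 0 0.
    by rewrite trmx_delta -colE [RHS]mxE -(rowE i A) mxE.
  by have := PQ (of_real_row (delta_mx 0 i)) (of_real_row (delta_mx 0 j)); rewrite !of_real_rowK -!mE.
have Su : S \in unitmx.
  rewrite -row_free_unit; apply: inj_row_free => v vS; apply/eqP/negPn/negP => v0.
  have : of_real_row v != 0.
    apply: contra v0 => /eqP v0; rewrite -(of_real_rowK v) v0.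
    by rewrite /real_row row_mx0.
  by move/posB; rewrite SE of_real_rowK vS mul0mx mxE ltxx.
have SJ : real_mx mulI *m S = - (S *m (real_mx mulI)^T).
  apply: mxP => X Y; rewrite mulmxA -(real_mxE _ mulI_linear) -SE JB' SE.
  by rewrite (real_mxE _ mulI_linear) trmx_mul mulmxN mulNmx !mulmxA [RHS]mxE.
have bS : real_mx b *m S = real_mx f *m S - S *m (real_mx f)^T.
  apply: mxP => X Y; rewrite mulmxBr mulmxBl [RHS]mxE [X in _ + X]mxE !mulmxA.
  rewrite -(real_mxE _ lb) -(real_mxE _ lf) -SE H -SE; congr (_ - _).
  by rewrite -mulmxA -trmx_mul -(real_mxE _ lf) -SE symB.
have -> : imtr b = - 2^-1 * \tr (real_mx b *m S *m (invmx S *m real_mx mulI)).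
  by rewrite imtrE// mulmxA mulmxK.
rewrite bS mulmxBl raddfB /=.
have -> : \tr (real_mx f *m S *m (invmx S *m real_mx mulI)) = \tr (real_mx f *m real_mx mulI).
  by rewrite mulmxA mulmxK.
have -> : \tr (S *m (real_mx f)^T *m (invmx S *m real_mx mulI)) =
    - \tr (real_mx f *m real_mx mulI).
  rewrite -mulmxA mxtrace_mulC -!mulmxA SJ !mulmxN mulKmx//.
  by rewrite -trmx_mul raddfN /= mxtrace_tr mxtrace_mulC.
by rewrite imtrE//; ring.
Qed.

Lemma injective_linear_surj f : linear f -> (forall X, f X = 0 -> X = 0) ->
  forall Y, exists X, f X = Y.
Proof.
move=> lf inj Y.
have fu : real_mx f \in unitmx.
  rewrite -row_free_unit; apply: inj_row_free => v vf.
  have r0 : real_row 0 = 0 by rewrite /real_row row_mx0.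
  suff v0 : of_real_row v = 0 by rewrite -(of_real_rowK v) v0.
  apply: inj; apply: (can_inj real_rowK).
  by rewrite real_mxE// of_real_rowK vf r0.
exists (of_real_row (real_row Y *m invmx (real_mx f))).
apply: (can_inj real_rowK); rewrite real_mxE// of_real_rowK mulmxKV//.
Qed.
End Traces.

(** * Local holomorphic groups and their left-invariant frames *)

Section LocalGroup.
Context {R : realType} {E : normedModType R} (J : E -> E).

Lemma derive_pair (E' F G : normedModType R) (f : E' -> F) (g : E' -> G) x v :
  differentiable f x -> differentiable g x ->
  'D_v (fun z => (f z, g z)) x = ('D_v f x, 'D_v g x).
Proof.
move=> df dg; rewrite deriveE; last exact: differentiable_pair.
by rewrite diff_pair// !deriveE.
Qed.

(** The set [W] carries smoothness and holomorphy only; the group identities hold near the base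
    point. Associativity is a nested [near], so that [x] and then [y] can be fixed before
    differentiating in [z]. *)
Record local_group (x0 : E) (W : set (E * E)) (m : E * E -> E) : Prop := LocalGroup {
  lg_open : open W;
  lg_base : W (x0, x0);
  lg_smooth : smooth_on W m;
  lg_holo : forall z Z, W z -> 'D_(J Z.1, J Z.2) m z = J ('D_Z m z);
  lg_unitr : \forall x \near x0, m (x, x0) = x;
  lg_unitl : \forall y \near x0, m (x0, y) = y;
  lg_assoc : \forall x \near x0, \forall y \near x0, \forall z \near x0,
    m (m (x, y), z) = m (x, m (y, z)) }.

(** The left-invariant field with value [v] at [x0], written as a directional derivative of [m] on
    the product so that its smoothness in [x] comes from that of [m]. *)
Definition frame (x0 : E) (m : E * E -> E) (x v : E) : E := 'D_(0, v) m (x, x0).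
(** The mixed second derivative of [m] at [(x0, x0)]. *)
Definition frame_diff x0 m (u v : E) : E := 'D_u (fun x => frame x0 m x v) x0.
(** The frame being the identity at [x0], this is the Lie bracket at [x0] of the left-invariant
    fields with values [u] and [v] there. *)
Definition bracket x0 m (u v : E) : E := frame_diff x0 m u v - frame_diff x0 m v u.

Variables (x0 : E) (W : set (E * E)) (m : E * E -> E).
Hypothesis cE : finite_coordinates E.
Hypothesis linJ : linear J.
Hypothesis H : local_group x0 W m.
Local Notation A := (frame x0 m).
Local Notation a := (frame_diff x0 m).
Local Notation c := (bracket x0 m).

Let J0 : J 0 = 0. Proof. by case: (linear_bundle linJ) => g ->; rewrite linear0. Qed.

Let U := [set x | W (x, x0)].

Lemma smooth_pair_cst (V : set E) (y : E) : open V -> smooth_on V (fun x => (x, y)).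
Proof.
move=> oV; apply: smooth_on_pair => //; last exact: smooth_on_cst.
by apply: smooth_on_linear => //; split=> // z; exact: cvg_id.
Qed.

Lemma smooth_cst_pair (V : set E) (x : E) : open V -> smooth_on V (fun y => (x, y)).
Proof.
move=> oV; apply: smooth_on_pair => //; first exact: smooth_on_cst.
by apply: smooth_on_linear => //; split=> // z; exact: cvg_id.
Qed.

Lemma derive_pair_cst (x y v : E) : 'D_v (fun x => (x, y) : E * E) x = (v, 0).
Proof.
have di : differentiable (id : E -> E) x by apply: continuous_linear_diff; split=> // z; exact: cvg_id.
have := derive_pair v di (differentiable_cst y x).
by rewrite derive_id derive_cst.
Qed.

Lemma derive_cst_pair (x y v : E) : 'D_v (fun y => (x, y) : E * E) y = (0, v).
Proof.
have di : differentiable (id : E -> E) y by apply: continuous_linear_diff; split=> // z; exact: cvg_id.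
have := derive_pair v (differentiable_cst x y) di.
by rewrite derive_id derive_cst.
Qed.

Lemma open_fst_slice y : open [set x | W (x, y)].
Proof.
apply: (@open_comp _ _ (fun x => (x, y)) W); last exact: lg_open H.
move=> x _; apply: differentiable_continuous; exact: (smooth_on_diff (smooth_pair_cst y openT)).
Qed.

Lemma open_snd_slice x : open [set y | W (x, y)].
Proof.
apply: (@open_comp _ _ (fun y => (x, y)) W); last exact: lg_open H.
move=> y _; apply: differentiable_continuous; exact: (smooth_on_diff (smooth_cst_pair x openT)).
Qed.

Lemma lg_diff z : W z -> differentiable m z.
Proof. exact: smooth_on_diff (lg_smooth H). Qed.

Lemma derive_right x y v : W (x, y) -> 'D_v (fun y => m (x, y)) y = 'D_(0, v) m (x, y).
Proof.
move=> Wxy; rewrite (derive_comp (g := m) v _ (lg_diff Wxy)) ?derive_cst_pair//.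
exact: (smooth_on_diff (smooth_cst_pair x openT)).
Qed.

Lemma frameE x v : U x -> A x v = 'D_v (fun y => m (x, y)) x0.
Proof. by move=> Ux; rewrite derive_right. Qed.

Lemma smooth_right x : smooth_on [set y | W (x, y)] (fun y => m (x, y)).
Proof.
apply: (smooth_on_comp (f := fun y => (x, y)) (g := m)
  (finite_coordinates_prod cE cE) (open_snd_slice x) _ _ (lg_smooth H)) => //.
exact: smooth_cst_pair (open_snd_slice x).
Qed.

Lemma near_frame_dom : \forall x \near x0, U x.
Proof. exact: open_nbhs_nbhs (conj (open_fst_slice x0) (lg_base H)). Qed.

Lemma frame_smooth v : smooth_on U (fun x => A x v).
Proof.
apply: (smooth_on_comp (f := fun x => (x, x0)) (g := fun z => 'D_(0, v) m z)
  (finite_coordinates_prod cE cE) (open_fst_slice x0) _ _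
  (smooth_on_derive (0, v) (lg_smooth H))) => //.
exact: smooth_pair_cst (open_fst_slice x0).
Qed.

Lemma frame_differentiable v x : U x -> differentiable (fun x => A x v) x.
Proof. exact: smooth_on_diff (frame_smooth v). Qed.

Lemma frame_linear x : U x -> linear (A x).
Proof.
move=> Ux k u v; rewrite /frame -(derive_linear (lg_diff Ux)); congr ('D_ _ _ _).
by congr (_, _); rewrite /= scaler0 addr0.
Qed.

Lemma frame_J x v : U x -> A x (J v) = J (A x v).
Proof.
move=> Ux; have e : (0 : E, J v) = (J (0 : E, v).1, J (0 : E, v).2).
  by rewrite /= J0.
by rewrite /frame e; exact: (lg_holo H (0, v) Ux).
Qed.

(** Symmetry of second derivatives turns the derivative of the frame along [X] into the derivative
    along [(0, v)] of ['D_(X, 0) m], where [J] comes out by holomorphy of [m] in its first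
    argument. *)
Lemma frame_holo x X v : U x ->
  'D_(J X) (fun x => A x v) x = J ('D_X (fun x => A x v) x).
Proof.
move=> Ux.
have Wn z : W z -> \forall z \near z, W z by move=> Wz; exact: open_nbhs_nbhs (conj (lg_open H) Wz).
have DE Y : 'D_Y (fun x => A x v) x = 'D_(0, v) (fun z => 'D_(Y, 0) m z) (x, x0).
  rewrite (derive_comp (g := fun z => 'D_(0, v) m z) Y (smooth_on_diff (smooth_pair_cst x0 openT) I));
     last exact: smooth_on_diff (smooth_on_derive _ (lg_smooth H)) Ux.
  rewrite derive_pair_cst; apply: (derive_swap cE).
  - by apply: filterS (Wn _ Ux) => z; exact: lg_diff.
  - exact: smooth_on_diff (smooth_on_derive _ (lg_smooth H)) Ux.
  - exact: smooth_on_diff (smooth_on_derive _ (lg_smooth H)) Ux.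
rewrite !DE.
have dX := smooth_on_diff (smooth_on_derive (X, 0) (lg_smooth H)) Ux.
have cJ := finite_coordinates_continuous cE linJ.
rewrite -(continuous_linear_derive ('D_(X, 0) m (x, x0))
  ('D_(0, v) (fun z => 'D_(X, 0) m z) (x, x0)) cJ).
rewrite -(derive_comp (0, v) dX (continuous_linear_diff _ cJ)).
apply: near_eq_derive; apply: filterS (Wn _ Ux) => z Wz.
have e : (J X, 0 : E) = (J (X, 0 : E).1, J (X, 0 : E).2).
  by rewrite /= J0.
by rewrite e; exact: (lg_holo H (X, 0) Wz).
Qed.

Lemma frame_base v : A x0 v = v.
Proof.
rewrite frameE; last exact: lg_base H.
by rewrite (near_eq_derive v (lg_unitl H)) derive_id.
Qed.

(** Left translation by [x] preserves the frame: differentiate [m (m (x, y), z) = m (x, m (y, z))]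
    in [z] at [x0]. *)
Lemma frame_equivariant : \forall x \near x0, U x /\ m (x, x0) = x /\
  \forall y \near x0, forall v, A (m (x, y)) v = 'D_(A y v) (fun y => m (x, y)) y.
Proof.
near=> x.
have Ux : U x by near: x; exact: near_frame_dom.
have mx : m (x, x0) = x by near: x; exact: lg_unitr H.
have ass : \forall y \near x0, \forall z \near x0, m (m (x, y), z) = m (x, m (y, z)).
  by near: x; exact: lg_assoc H.
split=> //; split=> //; near=> y => v.
have Uy : U y by near: y; exact: near_frame_dom.
have my : m (y, x0) = y by near: y; exact: lg_unitr H.
have Wxy : W (x, y).
  by near: y; exact: open_nbhs_nbhs (conj (open_snd_slice x) Ux).
have Um : U (m (x, y)).
  near: y; have /differentiable_continuous cm := smooth_on_diff (smooth_right (x:=x)) Ux.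
  apply: cm; rewrite mx; exact: open_nbhs_nbhs (conj (open_fst_slice x0) Ux).
have assy : \forall z \near x0, m (m (x, y), z) = m (x, m (y, z)).
  by near: y; exact: ass.
rewrite (frameE v Um) (near_eq_derive v assy).
have d1 := smooth_on_diff (smooth_right (x:=y)) Uy.
have d2 : differentiable (fun z => m (x, z)) (m (y, x0)).
  by rewrite my; exact: smooth_on_diff (smooth_right (x:=x)) Wxy.
by rewrite (derive_comp (g := fun z => m (x, z)) v d1 d2) my -frameE.
Unshelve. all: by end_near. Qed.

Lemma derive_family (L : E -> E -> E) (f : E -> E) x X :
  (\forall z \near x, linear (L z)) -> (forall w, differentiable (fun z => L z w) x) ->
  differentiable f x ->
  'D_X (fun z => L z (f z)) x = 'D_X (fun z => L z (f x)) x + L x ('D_X f x).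
Proof. by move=> *; apply: (derive_linear_family X cE _ _ _).2. Qed.

Lemma near_frame_dom_at x : U x -> \forall x \near x, U x.
Proof. by move=> Ux; exact: open_nbhs_nbhs (conj (open_fst_slice x0) Ux). Qed.

(** Left translation by [x] sends [x0] to [x] and preserves the frame. Differentiating this relation
    at [x0] expresses the derivative of the frame at [x] as a second derivative of the translation,
    symmetric in [u] and [v], plus [A x (a u v)]; the symmetric part drops out of the difference. *)
Lemma frame_bracket : \forall x \near x0, forall u v,
  'D_(A x u) (fun z => A z v) x - 'D_(A x v) (fun z => A z u) x = A x (c u v).
Proof.
have UU : U x0 := lg_base H.
apply: filterS frame_equivariant => x [Ux [mx eqv]] u v.
have tsm := smooth_right (x:=x).
have tu u' : 'D_u' (fun y => m (x, y)) x0 = A x u' := esym (frameE u' Ux).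
have Wn : \forall y \near x0, W (x, y) by exact: open_nbhs_nbhs (conj (open_snd_slice x) Ux).
have [t tE] : exists t, t = fun y => m (x, y) by eexists.
rewrite -tE in tsm tu; have {mx}tx : t x0 = x by rewrite tE.
have {}eqv : \forall y \near x0, forall v, A (t y) v = 'D_(A y v) t y by rewrite tE.
have key u' v' : 'D_(A x u') (fun z => A z v') x =
    'D_u' (fun y => 'D_v' t y) x0 + A x (a u' v').
  have dt : differentiable t x0 by exact: smooth_on_diff tsm Ux.
  have dA : differentiable (fun z => A z v') (t x0) by rewrite tx; exact: frame_differentiable.
  have E1 := derive_comp (g := fun z => A z v') u' dt dA.
  have E2 := f_equal2 (fun p q => 'D_p (fun z => A z v') q) (tu u') tx.
  apply: etrans (esym E2) _; apply: etrans (esym E1) _.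
  have eqv' : \forall y \near x0, A (t y) v' = 'D_(A y v') t y.
    by apply: filterS eqv => y; apply.
  apply: etrans (near_eq_derive u' eqv') _.
  apply: etrans (derive_family (L := fun y w => 'D_w t y) (f := fun y => A y v') u' _ _ _) _.
- by apply: filterS Wn => y Wy; apply: derive_linear; exact: smooth_on_diff tsm Wy.
  - by move=> w; exact: smooth_on_diff (smooth_on_derive w tsm) Ux.
  - exact: frame_differentiable.
  have e1 : 'D_u' (fun z => 'D_(A x0 v') t z) x0 = 'D_u' (fun z => 'D_v' t z) x0.
    exact: (f_equal (fun w => 'D_u' (fun z => 'D_w t z) x0) (frame_base v')).
  have e2 := tu (a u' v').
  exact: (f_equal2 (fun p q : E => p + q) e1 e2).
have fin P Q : P = Q -> P + A x (a u v) - (Q + A x (a v u)) = A x (c u v).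
  move=> ->; rewrite /bracket opprD addrACA subrr add0r.
  by have [g ->] := linear_bundle (frame_linear Ux); rewrite linearB.
apply: etrans (f_equal2 (fun p q => p - q) (key u v) (key v u)) _; apply: fin.
apply: (derive_swap cE).
- by apply: filterS Wn => y Wy; exact: smooth_on_diff tsm Wy.
- exact: smooth_on_diff (smooth_on_derive _ tsm) Ux.
- exact: smooth_on_diff (smooth_on_derive _ tsm) Ux.
Qed.

End LocalGroup.

Section PointwiseDerive.
Context {R : realType} {E F : normedModType R}.
Implicit Types f g : E -> F.

Lemma derive_add f g x v : differentiable f x -> differentiable g x ->
  'D_v (fun z => f z + g z) x = 'D_v f x + 'D_v g x.
Proof. by move=> df dg; apply: deriveD; exact: diff_derivable. Qed.

Lemma derive_sub f g x v : differentiable f x -> differentiable g x ->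
  'D_v (fun z => f z - g z) x = 'D_v f x - 'D_v g x.
Proof. by move=> df dg; apply: deriveB; exact: diff_derivable. Qed.

Lemma derive_scale (k : R) f x v : differentiable f x ->
  'D_v (fun z => k *: f z) x = k *: 'D_v f x.
Proof. by move=> df; apply: deriveZ; exact: diff_derivable. Qed.
End PointwiseDerive.

(** * The Lie algebra of a local group and its Jacobi identity *)

Section LocalLieAlgebra.
Context {R : realType} {E : normedModType R} (J : E -> E).
Variables (x0 : E) (W : set (E * E)) (m : E * E -> E).
Hypothesis cE : finite_coordinates E.
Hypothesis linJ : linear J.
Hypothesis H : local_group J x0 W m.
Local Notation A := (frame x0 m).
Local Notation a := (frame_diff x0 m).
Local Notation c := (bracket x0 m).

Definition frame_diff2 (w u v : E) : E := 'D_w (fun z => 'D_u (fun x => A x v) z) x0.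
Local Notation q := frame_diff2.

Let U0 : W (x0, x0) := lg_base H.

Lemma frame_diff_linear_l v : linear (fun u => a u v).
Proof. exact: derive_linear (frame_differentiable cE H v U0). Qed.

Lemma frame_diff_linear_r u : linear (a u).
Proof.
move=> k v w.
have dA v' := frame_differentiable cE H v' U0.
have e : \forall x \near x0, A x (k *: v + w) = k *: A x v + A x w.
  by apply: filterS (near_frame_dom H) => x Ux; exact: (frame_linear H).
apply: etrans (near_eq_derive u e) _.
have dz : differentiable (fun x => k *: A x v) x0 by exact: differentiableZ.
apply: etrans (derive_add u dz (dA w)) _; congr (_ + _).
exact: derive_scale.
Qed.

Lemma frame_diff_J_l u v : a (J u) v = J (a u v).
Proof. exact: (frame_holo cE linJ H). Qed.

Lemma frame_diff_J_r u v : a u (J v) = J (a u v).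
Proof.
have dA v' := frame_differentiable cE H v' U0.
have e : \forall x \near x0, A x (J v) = J (A x v).
  by apply: filterS (near_frame_dom H) => x Ux; exact: (frame_J linJ H).
apply: etrans (near_eq_derive u e) _.
have dI := continuous_linear_diff (A x0 v) (finite_coordinates_continuous cE linJ).
apply: etrans (derive_comp (g := J) u (dA v) dI) _.
by rewrite (continuous_linear_derive _ _ (finite_coordinates_continuous cE linJ)).
Qed.

Lemma frame_diff2C w u v : q w u v = q u w v.
Proof.
apply: (derive_swap (cE)).
- by apply: filterS (near_frame_dom H) => x Ux; exact: (frame_differentiable cE H).
- exact: smooth_on_diff (smooth_on_derive _ (frame_smooth cE H v)) U0.
- exact: smooth_on_diff (smooth_on_derive _ (frame_smooth cE H v)) U0.
Qed.

(** The second term comes from the direction [A x u], which varies at the rate [a w u] along [w]. *)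
Lemma derive_frame_derive w u v :
  differentiable (fun x => 'D_(A x u) (fun z => A z v) x) x0 /\
  'D_w (fun x => 'D_(A x u) (fun z => A z v) x) x0 = q w u v + a (a w u) v.
Proof.
have [|||d e] := derive_linear_family (L := fun x w => 'D_w (fun z => A z v) x)
  (a := fun x => A x u) (x := x0) w (cE).
- by apply: filterS (near_frame_dom H) => x Ux; apply: derive_linear; exact: (frame_differentiable cE H).
- by move=> w'; exact: smooth_on_diff (smooth_on_derive _ (frame_smooth cE H v)) U0.
- exact: (frame_differentiable cE H).
split; first exact: d.
have e' := f_equal (fun p => 'D_w (fun z => 'D_p (fun x => A x v) z) x0) (frame_base H u).
rewrite /= in e e'; rewrite e.
exact: (f_equal (fun p : E => p + a (a w u) v) e').
Qed.

(** The derivative of [frame_bracket] at [x0] along [w]; constancy of [c u v] leaves only the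
    derivative of the frame on the right. *)
Lemma derive_bracket w u v :
  (q w u v + a (a w u) v) - (q w v u + a (a w v) u) = a w (c u v).
Proof.
have [d1 e1] := derive_frame_derive w u v.
have [d2 e2] := derive_frame_derive w v u.
apply: etrans (f_equal2 (fun p q : E => p - q) (esym e1) (esym e2)) _.
apply: etrans (esym (derive_sub w d1 d2)) _.
apply: near_eq_derive; apply: filterS (frame_bracket cE H) => x; exact.
Qed.

Lemma bracket_linear_r u : linear (c u).
Proof.
move=> k v w; have l : a (k *: v + w) u = k *: a v u + a w u := frame_diff_linear_l u k v w.
rewrite /bracket (frame_diff_linear_r u k v w) l.
by rewrite opprD addrACA scalerBr.
Qed.

Lemma bracketC u v : c u v = - c v u.
Proof. by rewrite /bracket opprB. Qed.

Lemma bracket_J_r u v : c u (J v) = J (c u v).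
Proof.
rewrite /bracket frame_diff_J_l frame_diff_J_r.
by have [g ->] := linear_bundle linJ; rewrite linearB.
Qed.

Lemma jacobi_sum (q1 q2 q3 a1 a2 a3 a4 a5 a6 : E) :
  a3 - a5 - (q2 + a1 - (q3 + a2)) =
  q1 + a3 - (q2 + a4) - (a6 - a2) - (q1 + a5 - (q3 + a6) - (a4 - a1)).
Proof.
apply: (finite_coordinates_ext cE) => g.
have gD x y : g (x + y) = g x + g y := linearD g x y.
have gN x : g (- x) = - g x := linearN g x.
rewrite !gD !gN !gD !gN; ring.
Qed.

(** Each double bracket contains one term of the shape [a w (c u v)]. Here [derive_bracket] trades
    it for second derivatives of the frame, which cancel by their symmetry, and for iterates of
    [a]. *)
Lemma bracket_jacobi u v w : c (c u v) w = c u (c v w) - c v (c u w).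
Proof.
have aB x y z : a (x - y) z = a x z - a y z.
  have [g gE] := linear_bundle (frame_diff_linear_l z).
  have {}gE t : a t z = g t by rewrite -gE.
  by rewrite !gE linearB.
have cl x y z : c (c x y) z = a (a x y) z - a (a y x) z - a z (c x y).
  exact: (f_equal (fun p : E => p - a z (c x y)) (aB (a x y) (a y x) z)).
have cr z x y : c z (c x y) = a z (c x y) - (a (a x y) z - a (a y x) z).
  exact: (f_equal (fun p : E => a z (c x y) - p) (aB (a x y) (a y x) z)).
rewrite (cl u v w) (cr u v w) (cr v u w).
rewrite -(derive_bracket w u v) -(derive_bracket u v w) -(derive_bracket v u w).
rewrite (frame_diff2C v u w) (frame_diff2C w u v) (frame_diff2C w v u).
exact: jacobi_sum.
Qed.

End LocalLieAlgebra.

Section BracketTrace.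
Context {R : realType} {n : nat}.
Local Notation E := (Cspace R n).

Lemma imtr_bracket (x0 : E) (W : set (E * E)) (m : E * E -> E) u v :
  local_group (@mulI R n) x0 W m ->
  imtr (bracket x0 m (bracket x0 m u v)) = 0.
Proof.
move=> H; set c := bracket x0 m.
have lc u' : linear (c u') := bracket_linear_r (finite_coordinates_Cspace n) H u'.
have Jc u' v' : c u' (mulI v') = mulI (c u' v').
  exact: (bracket_J_r (finite_coordinates_Cspace n) (@mulI_linear R n) H).
have -> : imtr (c (c u v)) = imtr (fun w => c u (c v w)) - imtr (fun w => c v (c u w)).
  rewrite /imtr -sumrB; apply: eq_bigr => k _.
  have -> := bracket_jacobi (finite_coordinates_Cspace n) H u v (basisC k) : c _ _ = c _ _ - c _ _.
  by move: (c u _) (c v _) => [? ?] [? ?]; rewrite /= !mxE.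
apply/eqP; rewrite subr_eq0; apply/eqP; exact: imtr_mulC (lc u) (Jc u) (lc v) (Jc v).
Qed.
End BracketTrace.

(** * Hermitian connections in an invariant frame *)

Section FrameConnection.
Context {R : realType} {E : normedModType R} (J : E -> E).
Variables (x0 : E) (W : set (E * E)) (m : E * E -> E).
Hypothesis cE : finite_coordinates E.
Hypothesis linJ : linear J.
Hypothesis JK : forall v, J (J v) = - v.
Hypothesis surjE : forall f : E -> E, linear f -> (forall X, f X = 0 -> X = 0) ->
  forall Y, exists X, f X = Y.
Hypothesis H : local_group J x0 W m.
Local Notation A := (frame x0 m).
Local Notation a := (frame_diff x0 m).
Local Notation c := (bracket x0 m).
Local Notation q := (frame_diff2 x0 m).

(** What a metric and a Hermitian connection look like in one chart; [lh_invariant] is the field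
    that ties them to the local group. *)
Record local_hermitian (V : set E) (g : E -> E -> E -> R) (D : E -> E -> E -> E) : Prop :=
  LocalHermitian {
  lh_open : open V;
  lh_base : V x0;
  lh_diff : forall X Y x, V x -> differentiable (fun x => D x X Y) x;
  lh_linear_l : forall Y x, V x -> linear (fun X => D x X Y);
  lh_linear_r : forall X x, V x -> linear (D x X);
  lh_J : forall x X Y, V x -> D x X (J Y) = J (D x X Y);
  lh_gdiff : forall X Y x, V x -> differentiable (fun x => g x X Y) x;
  lh_glinear : forall X x, V x -> linear (g x X : E -> R);
  lh_gsym : forall x X Y, V x -> g x X Y = g x Y X;
  lh_gpos : forall x X, V x -> X != 0 -> 0 < g x X X;
  lh_gJ : forall x X Y, V x -> g x (J X) (J Y) = g x X Y;
  lh_compat : forall x X Y Z, V x ->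
    'D_X (fun z => g z Y Z) x = g x (D x X Y) Z + g x Y (D x X Z);
  lh_invariant : \forall x \near x0, forall v w, g x (A x v) (A x w) = g x0 v w }.

Variables (V : set E) (g : E -> E -> E -> R) (D : E -> E -> E -> E).
Hypothesis HD : local_hermitian V g D.

(** The covariant derivative along [X] of the frame field [A v]. *)
Definition cov_frame (x X v : E) : E := D x X (A x v) + 'D_X (fun z => A z v) x.
Local Notation K := cov_frame.
Definition frame_coef (x u v w : E) : R := g x (K x (A x u) v) (A x w).
Local Notation C := frame_coef.

Definition torsion_at (x X Y : E) : E := D x X Y - D x Y X.

Lemma near_metric_dom : \forall x \near x0, V x.
Proof. exact: open_nbhs_nbhs (conj (lh_open HD) (lh_base HD)). Qed.

Lemma local_metric_J x X Y : V x -> g x (J X) Y = - g x X (J Y).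
Proof.
move=> Vx; rewrite -[in RHS](lh_gJ HD X (J Y) Vx) JK.
by have [h ->] := linear_bundle (lh_glinear HD (J X) Vx); rewrite linearN opprK.
Qed.

Lemma local_metric_linear_l Y x : V x -> linear (fun X => g x X Y : R).
Proof.
move=> Vx k u v; rewrite !(lh_gsym HD _ Y Vx).
exact: lh_glinear HD Y x Vx k u v.
Qed.

(** The function [g (A v) (A w)] is constant near [x0], and by metric compatibility its derivative
    is the sum of the two pairings. *)
Lemma cov_frame_skew : \forall x \near x0, forall X v w,
  g x (K x X v) (A x w) = - g x (A x v) (K x X w).
Proof.
near=> x => X v w.
have Ux : W (x, x0) by near: x; exact: near_frame_dom H.
have Vx : V x by near: x; exact: near_metric_dom.
(* To be differentiated at [x], invariance must hold on a neighbourhood of [x] and not just at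
   [x]. *)
have inv : \forall z \near x, forall v w, g z (A z v) (A z w) = g x0 v w.
  by near: x; apply: near_join; exact: lh_invariant HD.
have Vn : \forall z \near x, V z by exact: open_nbhs_nbhs (conj (lh_open HD) Vx).
have dA v' : differentiable (fun z => A z v') x by exact: frame_differentiable cE H v' _ Ux.
have [|p||d1 e1] := derive_linear_family (L := fun z p => g z p (A x w) : R)
  (a := fun z => A z v) (x := x) X cE.
- by apply: filterS Vn => z Vz; exact: local_metric_linear_l.
- exact: lh_gdiff HD _ _ _ Vx.
- exact: dA.
have [|p||d2 e2] := derive_linear_family (L := fun z p => g z (A z v) p : R)
  (a := fun z => A z w) (x := x) X cE.
- by apply: filterS Vn => z Vz; exact: lh_glinear HD _ _ Vz.
- apply: (derive_linear_family (L := fun z p' => g z p' p : R)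
  (a := fun z => A z v) (x := x) X cE _ _ _).1.
  + by apply: filterS Vn => z Vz; exact: local_metric_linear_l.
  + by move=> p'; exact: lh_gdiff HD _ _ _ Vx.
  + exact: dA.
- exact: dA.
have e3 : 'D_X (fun z => g z (A z v) (A z w) : R) x = 0.
  have nc : \forall z \near x, g z (A z v) (A z w) = cst (g x0 v w) z.
    by apply: filterS inv => z ->.
  by rewrite (near_eq_derive X nc) derive_cst.
have e4 := lh_compat HD X (A x v) (A x w) Vx.
rewrite /= in e1 e2.
rewrite e3 e1 e4 in e2.
have kr : g x (A x v) (K x X w) =
    g x (A x v) (D x X (A x w)) + g x (A x v) ('D_X (fun z => A z w) x).
  by have [h ->] := linear_bundle (lh_glinear HD (A x v) Vx); rewrite linearD.
have kl : g x (K x X v) (A x w) =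
    g x (D x X (A x v)) (A x w) + g x ('D_X (fun z => A z v) x) (A x w).
  have [h hE] := linear_bundle (local_metric_linear_l (A x w) Vx).
  have {}hE p : g x p (A x w) = h p by rewrite -hE.
  by rewrite !hE linearD.
apply/eqP; rewrite -addr_eq0; apply/eqP; rewrite kl kr addrACA addrA; exact: esym e2.
Unshelve. all: by end_near. Qed.

Lemma cov_frame_J x X v : V x -> W (x, x0) -> K x X (J v) = J (K x X v).
Proof.
move=> Vx Ux; have JD p r : J (p + r) = J p + J r.
  by have [h ->] := linear_bundle linJ; rewrite linearD.
rewrite /K JD -(lh_J HD X (A x v) Vx); congr (_ + _).
  by congr (D x X _); apply: (frame_J linJ H).
have Un : \forall z \near x, A z (J v) = J (A z v).
  apply: filterS (near_frame_dom_at H Ux) => z Uz; by apply: (frame_J linJ H).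
have cJ := finite_coordinates_continuous cE linJ.
have dA := frame_differentiable cE H v Ux.
apply: etrans (near_eq_derive X Un) _.
apply: etrans (derive_comp (g := J) X dA (continuous_linear_diff _ cJ)) _.
exact: continuous_linear_derive _ _ cJ.
Qed.

Lemma cov_frame_torsion : \forall x \near x0, forall u v,
  K x (A x u) v - K x (A x v) u = torsion_at x (A x u) (A x v) + A x (c u v).
Proof.
near=> x => u v.
have br : 'D_(A x u) (fun z => A z v) x - 'D_(A x v) (fun z => A z u) x = A x (c u v).
  by move: u v; near: x; exact: frame_bracket cE H.
by rewrite -br /K /torsion_at opprD addrACA.
Unshelve. all: by end_near. Qed.

(** By skew-symmetry, moving [J] from any slot to any other changes the sign. A tour of the three
    slots takes three moves, so [T] with [J] inserted equals its own opposite. *)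
Lemma skew_tensor_eq0 (T : E -> E -> E -> R) :
  (forall u v w, T u v w = - T u w v) -> (forall u v w, T u v w = - T w v u) ->
  (forall u v w, T u (J v) w = - T u v (J w)) -> forall u v w, T u v w = 0.
Proof.
move=> s23 s13 TJ u v w.
have s12 u' v' w' : T u' v' w' = - T v' u' w' by rewrite s23 s13 s23 opprK.
have TJ0 u' v' w' : T u' (J v') w' = 0.
  have h1 : T (J u') v' w' = - T u' v' (J w') by rewrite s12 TJ s12 !opprK.
  have h2 : T (J u') v' w' = - T u' (J v') w'.
    by rewrite s23 s12 TJ s12 !opprK s23.
  have := TJ u' v' w'; move: h1; rewrite h2 => /oppr_inj <- e.
  by move/eqP: e; rewrite -addr_eq0 -mulr2n mulrn_eq0 => /eqP.
have := TJ0 u (J v) w; rewrite JK => TN.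
have := TJ0 u (J (- v)) w; rewrite JK opprK; exact.
Qed.

Section AtPoint.
Variable x : E.
Hypothesis Ux : W (x, x0).
Hypothesis Vx : V x.
Hypothesis inv : forall v w, g x (A x v) (A x w) = g x0 v w.
Hypothesis skew : forall X v w, g x (K x X v) (A x w) = - g x (A x v) (K x X w).

Lemma frame_coef_skew u v w : C x u v w = - C x u w v.
Proof. exact: etrans (skew (A x u) v w)
  (f_equal (fun r : R => - r) (lh_gsym HD (A x v) (K x (A x u) w) Vx)). Qed.

Lemma frame_coef_J u v w : C x u (J v) w = - C x u v (J w).
Proof.
rewrite /C (cov_frame_J _ _ Vx Ux) (local_metric_J _ _ Vx); congr (- g x _ _).
by rewrite (frame_J linJ H).
Qed.

(** The frame being holomorphic, [K] is complex linear in the direction. Moving [J] from [u] to [w]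
    then costs a minus sign if done directly, and none if the last two arguments are exchanged
    before and after. *)
Lemma frame_coef_chern : (forall X Y, D x (J X) Y = J (D x X Y)) ->
  forall u v w, C x u v w = 0.
Proof.
move=> ch u v w.
have JD p r : J (p + r) = J p + J r.
  by have [h ->] := linear_bundle linJ; rewrite linearD.
have KJ u' v' : K x (A x (J u')) v' = J (K x (A x u') v').
  rewrite /K (frame_J linJ H)// JD ch; congr (_ + _).
  by apply: (frame_holo cE linJ H).
have h1 u' v' w' : C x (J u') v' w' = - C x u' v' (J w').
  by rewrite /C KJ (local_metric_J _ _ Vx) (frame_J linJ H).
have h2 u' v' w' : C x (J u') v' w' = C x u' v' (J w').
  have e : C x (J u') w' v' = C x u' (J w') v' by rewrite h1 (frame_coef_J u' w' v').
  apply: etrans (frame_coef_skew (J u') v' w') _.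
  exact: etrans (f_equal (fun r : R => - r) e) (esym (frame_coef_skew u' v' (J w'))).
have z u' v' w' : C x u' v' (J w') = 0.
  have := h2 u' v' w'; rewrite h1 => /eqP.
  by rewrite eq_sym -addr_eq0 -mulr2n mulrn_eq0 => /eqP.
have := z u v (J (- w)); rewrite JK opprK; exact.
Qed.

(** This is the uniqueness of the Bismut connection, read in the frame. The difference [T] between
    the coefficients and the candidate is skew in the last two arguments and obeys the rule for [J];
    the torsion, written through [C] and the bracket, makes it skew in the outer two as well, so
    [skew_tensor_eq0] applies. *)
Lemma frame_coef_bismut :
  (forall X Y Z, g x (torsion_at x X Y) Z = - g x (torsion_at x X Z) Y) ->
  (forall u v, K x (A x u) v - K x (A x v) u = torsion_at x (A x u) (A x v) + A x (c u v)) ->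
  forall u v w, C x u v w = g x0 (c u v) w - g x0 (c u w) v.
Proof.
move=> ts tor u v w.
pose T u v w := C x u v w - (g x0 (c u v) w - g x0 (c u w) v).
have V0 := lh_base HD.
suff : T u v w = 0 by move/eqP; rewrite subr_eq0 => /eqP.
have cN u' v' : c u' v' = - c v' u' by exact: bracketC.
have gN u' v' : g x0 (- u') v' = - g x0 u' v'.
  have [h hE] := linear_bundle (local_metric_linear_l v' V0).
  have {}hE p : g x0 p v' = h p by rewrite -hE.
  by rewrite !hE linearN.
have tx u' v' w' : g x (torsion_at x (A x u') (A x v')) (A x w') =
     C x u' v' w' - C x v' u' w' - g x0 (c u' v') w'.
  have e : torsion_at x (A x u') (A x v') = K x (A x u') v' - K x (A x v') u' - A x (c u' v').
    by rewrite tor addrK.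
  have [h hE] := linear_bundle (local_metric_linear_l (A x w') Vx).
  have {}hE p : g x p (A x w') = h p by rewrite -hE.
  have hB p r : h (p - r) = h p - h r := linearB h p r.
  have lin p r t : g x (p - r - t) (A x w') = g x p (A x w') - g x r (A x w') - g x t (A x w').
    by rewrite !hE !hB.
  apply: etrans (f_equal (fun p => g x p (A x w')) e) _.
  exact: etrans (lin _ _ _)
    (f_equal (fun r : R => C x u' v' w' - C x v' u' w' - r) (inv (c u' v') w')).
apply: skew_tensor_eq0 => {u v w} u v w; rewrite /T.
- have pure (c1 p1 p2 : R) : - c1 - (p1 - p2) = - (c1 - (p2 - p1)) by lra.
  by rewrite (frame_coef_skew u v w); exact: pure.
- have pure (c1 c2 c3 c4 p1 p2 p3 n1 n2 n3 : R) : c3 = - c4 -> n1 = - p1 -> n2 = - p2 ->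
    n3 = - p3 -> c3 - c1 - n1 = - (c4 - c2 - n2) -> c1 - (p1 - p3) = - (c2 - (p2 - n3)).
    by move=> *; lra.
  have cg u' v' w' : g x0 (c u' v') w' = - g x0 (c v' u') w'.
    exact: etrans (f_equal (fun p => g x0 p w') (cN u' v')) (gN _ _).
  apply: (pure _ _ _ _ _ _ _ _ _ _ (frame_coef_skew v u w) (cg v u w) (cg v w u) (cg w u v)).
  exact: etrans (esym (tx v u w)) (etrans (ts (A x v) (A x u) (A x w))
    (f_equal (fun r : R => - r) (tx v w u))).
- have pure (c1 c2 p1 p2 p3 p4 : R) : c1 = - c2 -> p1 = - p3 -> p4 = - p2 ->
    c1 - (p1 - p2) = - (c2 - (p3 - p4)) by move=> *; lra.
  have cJ u' v' w' : g x0 (c u' (J v')) w' = - g x0 (c u' v') (J w').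
    exact: etrans (f_equal (fun p => g x0 p w') (bracket_J_r cE linJ H u' v')) (local_metric_J _ _ V0).
  exact: pure (frame_coef_J u v w) (cJ u v w) (cJ u w v).
Qed.

Lemma frame_surj Y : exists X, A x X = Y.
Proof.
apply: surjE; first by apply: (frame_linear H).
(* By invariance of the metric, a vector killed by [A x] has length zero at [x0]. *)
move=> X AX0; apply/eqP/negPn/negP => X0.
have := lh_gpos HD (lh_base HD) X0; rewrite -(inv X X) AX0.
have [h ->] := linear_bundle (lh_glinear HD 0 Vx).
by rewrite linear0 ltxx.
Qed.

Lemma cov_frame_const b : (forall u v w, C x u v w = g x0 (b u v) w) ->
  forall u v, K x (A x u) v = A x (b u v).
Proof.
move=> Cb u v; apply/eqP; rewrite -subr_eq0; apply/negPn/negP => n0.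
have := lh_gpos HD Vx n0.
have [w wE] := frame_surj (K x (A x u) v - A x (b u v)).
rewrite -{2}wE.
have [h hE] := linear_bundle (local_metric_linear_l (A x w) Vx).
have {}hE p : g x p (A x w) = h p by rewrite -hE.
by rewrite hE linearB -!hE inv -Cb subrr ltxx.
Qed.

End AtPoint.

Lemma connection_sum (T Z d1 d2 q0 s r b1 b2 : E) :
  T = Z + d1 + d2 + (q0 + s) -> b1 = d2 + s -> b2 = d1 + r ->
  Z = T - q0 - b1 - b2 + r.
Proof.
move=> -> -> ->.
apply: (finite_coordinates_ext cE) => h.
have hD x y : h (x + y) = h x + h y := linearD h x y.
have hN x : h (- x) = - h x := linearN h x.
rewrite !hD !hN !hD; ring.
Qed.

(** Both arguments of [D] move with the frame, whence two Leibniz terms; the relation [b = D + a] at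
    [x0] then rewrites the values of [D] as values of [b]. *)
Lemma derive_connection b :
  (\forall x \near x0, forall u v, K x (A x u) v = A x (b u v)) ->
  forall X u v, 'D_X (fun z => D z u v) x0 =
    a X (b u v) - q X u v - b (a X u) v - b u (a X v) + a u (a X v).
Proof.
move=> Hb X u v.
have V0 := lh_base HD; have W0 := lg_base H.
have dA v' := frame_differentiable cE H v' W0.
have A0 := frame_base H.
have b0 u' v' : b u' v' = D x0 u' v' + a u' v'.
  have := nbhs_singleton Hb u' v'; rewrite /K !A0 => <-; by congr (_ + _).
have [|p||d1 e1] := derive_linear_family (L := fun z p => D z p (A z v))
  (a := fun z => A z u) (x := x0) X cE.
- by apply: filterS near_metric_dom => z Vz; exact: lh_linear_l HD _ _ Vz.
- apply: (derive_linear_family (L := fun z p' => D z p p')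
  (a := fun z => A z v) (x := x0) X cE _ _ _).1.
  + by apply: filterS near_metric_dom => z Vz; exact: lh_linear_r HD _ _ Vz.
  + by move=> p'; exact: lh_diff HD _ _ _ V0.
  + exact: dA.
- exact: dA.
have [|p||d2 e2] := derive_linear_family (L := fun z p => D z (A x0 u) p)
  (a := fun z => A z v) (x := x0) X cE.
- by apply: filterS near_metric_dom => z Vz; exact: lh_linear_r HD _ _ Vz.
- exact: lh_diff HD _ _ _ V0.
- exact: dA.
have [d3 e3] := derive_frame_derive cE H X u v.
have e4 := derive_add X d1 d3.
have e5 : 'D_X (fun z => D z (A z u) (A z v) + 'D_(A z u) (fun z => A z v) z) x0 = a X (b u v).
  by apply: near_eq_derive; apply: filterS Hb => z; apply.
rewrite /= in e1 e2.
have e6 := etrans (esym e5) e4.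
have e7 := etrans e6 (f_equal2 (fun p r : E => p + r)
  (etrans e1 (f_equal (fun p : E => p + _) e2)) e3).
have e8 := etrans e7 (f_equal2 (fun p r : E => 'D_X (fun z => D z p r) x0 + D x0 p (a X v) +
  D x0 (a X u) r + (q X u v + a (a X u) v)) (A0 u) (A0 v)).
exact: connection_sum e8 (b0 (a X u) v) (b0 u (a X v)).
Qed.

Let b := K x0.
Let V0 : V x0 := lh_base HD.
Let W0 : W (x0, x0) := lg_base H.

Lemma coef_linear_r u : linear (b u).
Proof.
move=> k v w; have e : A x0 (k *: v + w) = k *: A x0 v + A x0 w by apply: (frame_linear H).
have e1 : D x0 u (A x0 (k *: v + w)) = k *: D x0 u (A x0 v) + D x0 u (A x0 w).
  by rewrite e (lh_linear_r HD u V0).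
have e2 : a u (k *: v + w) = k *: a u v + a u w := frame_diff_linear_r cE H u k v w.
have fin (p1 p2 r1 r2 : E) : k *: p1 + p2 + (k *: r1 + r2) = k *: (p1 + r1) + (p2 + r2).
  by rewrite scalerDr addrACA.
exact: etrans (f_equal2 (fun p r : E => p + r) e1 e2) (fin _ _ _ _).
Qed.

Lemma coef_sub_l u v w : b (u - v) w = b u w - b v w.
Proof.
have [h hE] := linear_bundle (lh_linear_l HD (A x0 w) V0).
have {}hE p : D x0 p (A x0 w) = h p by rewrite -hE.
have [h' hE'] := linear_bundle (frame_diff_linear_l cE H w).
have {}hE' p : 'D_p (fun z => A z w) x0 = h' p by rewrite -hE'.
by rewrite /b /cov_frame !hE !hE' !linearB opprD addrACA.
Qed.

Lemma coef_J u v : b u (J v) = J (b u v).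
Proof. by apply: cov_frame_J. Qed.

Lemma near_at_point : \forall x \near x0, [/\ W (x, x0), V x,
  (forall v w, g x (A x v) (A x w) = g x0 v w) &
  (forall X v w, g x (K x X v) (A x w) = - g x (A x v) (K x X w))].
Proof.
near=> x; split; near: x.
- exact: near_frame_dom H.
- exact: near_metric_dom.
- exact: lh_invariant HD.
- exact: cov_frame_skew.
Unshelve. all: by end_near. Qed.

(** The constant pairings are already determined at [x0], so the only candidate is [b]; since the
    frame spans and the metric is definite at [x], equal pairings force equal vectors. *)
Lemma coef_const (f : E -> E -> E -> R) :
  (\forall x \near x0, forall u v w, C x u v w = f u v w) ->
  (forall u v w, g x0 (b u v) w = f u v w) /\
  \forall x \near x0, forall u v, K x (A x u) v = A x (b u v).
Proof.
move=> Cf.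
have A0 := frame_base H.
have fb u v w : g x0 (b u v) w = f u v w.
  have e := f_equal2 (fun p r : E => g x0 (K x0 p v) r) (esym (A0 u)) (esym (A0 w)).
  exact: etrans e (nbhs_singleton Cf u v w).
split=> //; apply: filterS2 near_at_point Cf => x [Ux Vx inv skew] Cx u v.
apply: (cov_frame_const Ux Vx inv) => u' v' w'.
by rewrite Cx fb.
Qed.

End FrameConnection.

Lemma curvature_term (R : realDomainType) (r1 r2 r3 r4 : R) :
  r1 = r4 -> r1 - r2 - r3 - r4 = - r2 - r3.
Proof. by move=> ->; ring. Qed.

Lemma curvature_sum (R : realDomainType) (q1 q2 b1 b2 a1 a2 bc : R) :
  q1 = q2 -> a1 = a2 -> bc = b1 - b2 -> bc = 0 ->
  - q1 - b1 + a1 - (- q2 - b2 + a2) = 0.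
Proof. by move=> -> -> -> e; rewrite -oppr0 -e; ring. Qed.

(** * The Ricci form at the base point of a local group *)

Section LocalRicci.
Context {R : realType} {n : nat}.
Local Notation E := (Cspace R n).

Lemma imtrB (f h : E -> E) : imtr (fun w => f w - h w) = imtr f - imtr h.
Proof. by rewrite /imtr -sumrB; apply: eq_bigr => k _; rewrite /= !mxE. Qed.

Lemma imtrD (f h : E -> E) : imtr (fun w => f w + h w) = imtr f + imtr h.
Proof. by rewrite /imtr -big_split; apply: eq_bigr => k _; rewrite /= !mxE. Qed.

Lemma imtr_eq (f h : E -> E) : (forall w, f w = h w) -> imtr f = imtr h.
Proof. by move=> fh; congr imtr; apply/funext. Qed.

Lemma derive_imtr (F : E -> E -> E) x X : (forall w, differentiable (fun z => F z w) x) ->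
  differentiable (fun z => imtr (F z)) x /\
  'D_X (fun z => imtr (F z)) x = imtr (fun w => 'D_X (fun z => F z w) x).
Proof.
move=> dF; rewrite /imtr.
have cl (k : 'I_n) : continuous_linear (fun Y : E => Y.2 0 k : R).
  apply: finite_coordinates_continuous (finite_coordinates_Cspace n) _.
  by move=> r [? ?] [? ?]; rewrite /= !mxE.
have dk k : differentiable (fun z => (F z (basisC k)).2 0 k : R) x.
  exact: (differentiable_comp (dF (basisC k)) (continuous_linear_diff _ (cl k))).
have [d e] := is_derive_bigsum (index_enum 'I_n) X dk.
split; first exact: d.
apply: etrans e _; apply: eq_bigr => k _.
apply: etrans (derive_comp (g := fun Y : E => Y.2 0 k : R) X (dF (basisC k))
  (continuous_linear_diff _ (cl k))) _.
exact: continuous_linear_derive _ _ (cl k).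
Qed.

Variables (x0 : E) (W : set (E * E)) (m : E * E -> E).
Variables (V : set E) (g : E -> E -> E -> R) (D : E -> E -> E -> E).
Hypothesis H : local_group (@mulI R n) x0 W m.
Hypothesis HD : local_hermitian (@mulI R n) x0 m V g D.
Let cE := finite_coordinates_Cspace (R := R) n.
Let linJ := @mulI_linear R n.
Local Notation A := (frame x0 m).
Local Notation a := (frame_diff x0 m).
Local Notation c := (bracket x0 m).
Local Notation q := (frame_diff2 x0 m).
Local Notation K := (cov_frame x0 m D).
Local Notation C := (frame_coef x0 m g D).
Let b := K x0.
Let V0 : V x0 := lh_base HD.
Let W0 : W (x0, x0) := lg_base H.

Lemma local_ricci0 X Y :
  (\forall x \near x0, forall u v, K x (A x u) v = A x (b u v)) ->
  imtr (b (c X Y)) = 0 ->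
  'D_X (fun z => imtr (D z Y)) x0 - 'D_Y (fun z => imtr (D z X)) x0 = 0.
Proof.
move=> Hb b0.
have dD u v : differentiable (fun z => D z u v) x0 by exact: lh_diff HD _ _ _ V0.
have key X' Y' : 'D_X' (fun z => imtr (D z Y')) x0 =
    - imtr (q X' Y') - imtr (b (a X' Y')) + imtr (fun w => a Y' (a X' w)).
  apply: etrans (derive_imtr X' (dD Y')).2 _.
  have e w := derive_connection cE H HD Hb X' Y' w.
  apply: etrans (imtr_eq e) _.
  apply: etrans (imtrD _ _) _; congr (_ + _).
  apply: etrans (imtrB _ _) _.
  apply: etrans (f_equal (fun r : R => r - _) (imtrB _ _)) _.
  apply: etrans (f_equal (fun r : R => r - _ - _) (imtrB _ _)) _.
  (* This equality of traces removes the two terms of [derive_connection] in which [a] and [b] are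
     composed. *)
  have cab : imtr (fun w => a X' (b Y' w)) = imtr (fun w => b Y' (a X' w)).
    apply: imtr_mulC.
    - exact: (frame_diff_linear_r cE H).
    - exact: (frame_diff_J_r cE linJ H).
    - exact: (coef_linear_r cE H HD).
    - exact: (coef_J cE linJ H HD).
  exact: curvature_term cab.
have qq : imtr (q X Y) = imtr (q Y X).
  by apply: imtr_eq => w; exact: (frame_diff2C cE H).
have aa : imtr (fun w => a Y (a X w)) = imtr (fun w => a X (a Y w)).
  apply: imtr_mulC.
  - exact: (frame_diff_linear_r cE H).
  - exact: (frame_diff_J_r cE linJ H).
  - exact: (frame_diff_linear_r cE H).
  - exact: (frame_diff_J_r cE linJ H).
have bb : imtr (b (c X Y)) = imtr (b (a X Y)) - imtr (b (a Y X)).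
  apply: etrans (imtr_eq _) (imtrB _ _) => w; exact: (coef_sub_l cE H HD).
exact: etrans (f_equal2 (fun r s : R => r - s) (key X Y) (key Y X)) (curvature_sum qq aa bb b0).
Qed.

Lemma local_chern_flat X Y : (forall x u v, V x -> D x (mulI u) v = mulI (D x u v)) ->
  'D_X (fun z => imtr (D z Y)) x0 - 'D_Y (fun z => imtr (D z X)) x0 = 0.
Proof.
move=> ch; have [|b0 bc] := coef_const (f := fun _ _ _ => 0) cE (@injective_linear_surj R n) H HD.
  apply: filterS (near_at_point cE H HD) => x [Ux Vx inv skew].
  apply: (frame_coef_chern cE linJ (@mulIK R n) H HD Ux Vx skew) => X' Y'.
  exact: ch.
apply: local_ricci0 bc _.
rewrite /imtr big1// => k _.
suff -> : b (c X Y) (basisC k) = 0 by rewrite mxE.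
apply/eqP/negPn/negP => /(lh_gpos HD V0).
by rewrite b0 ltxx.
Qed.

Lemma local_bismut_flat X Y :
  (forall x X Y Z, V x -> g x (torsion_at D x X Y) Z = - g x (torsion_at D x X Z) Y) ->
  'D_X (fun z => imtr (D z Y)) x0 - 'D_Y (fun z => imtr (D z X)) x0 = 0.
Proof.
move=> ts; have [|b0 bc] := coef_const (f := fun u v w => g x0 (c u v) w - g x0 (c u w) v)
  cE (@injective_linear_surj R n) H HD.
  have nt := cov_frame_torsion cE H D.
  apply: filterS2 (near_at_point cE H HD) nt => x [Ux Vx inv skew] tor.
  apply: (frame_coef_bismut cE linJ (@mulIK R n) H HD Ux Vx inv skew _ tor) => X' Y' Z'.
  exact: ts.
apply: local_ricci0 bc _.
rewrite (imtr_skew_part (B := g x0) (f := c (c X Y))).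
- by rewrite (imtr_bracket X Y H) mulr0.
- by move=> Z; exact: lh_glinear HD _ _ V0.
- by move=> *; apply: (lh_gsym HD).
- by move=> *; apply: (lh_gpos HD).
- by move=> *; apply: (lh_gJ HD).
- exact: (bracket_linear_r cE H).
- exact: (bracket_J_r cE linJ H).
- exact: (coef_linear_r cE H HD).
- exact: (coef_J cE linJ H HD).
- by move=> u v; rewrite b0.
Qed.

End LocalRicci.

(** * The local group of a chart of the quotient *)

Section HolomorphicNear.
Context {R : realType}.

(** Holomorphy of a germ: with the open set hidden, maps can be composed, or replaced by locally
    equal ones, without following their domains. *)
Definition hol_near (E F : normedModType R) (JE : E -> E) (JF : F -> F) (x : E) (f : E -> F) :=
  exists B : set E, [/\ open B, B x & holomorphic_wrt JE JF B f].

Lemma hol_near_sub (E F : normedModType R) (JE : E -> E) (JF : F -> F) (S : set E) x f :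
  nbhs x S -> holomorphic_wrt JE JF S f -> hol_near JE JF x f.
Proof.
move=> Sx [sf hf]; exists S°; split; first exact: open_interior.
  by [].
split; first by apply: smooth_on_sub sf; exact: interior_subset.
by move=> z X /interior_subset; exact: hf.
Qed.

Lemma hol_near_diff (E F : normedModType R) (JE : E -> E) (JF : F -> F) x (f : E -> F) :
  hol_near JE JF x f -> \forall z \near x, differentiable f z.
Proof.
move=> [B [oB Bx [sf _]]]; apply: filterS (open_nbhs_nbhs (conj oB Bx)) => z.
exact: smooth_on_diff.
Qed.

Lemma hol_near_eq (E F : normedModType R) (JE : E -> E) (JF : F -> F) x (f h : E -> F) :
  {near x, f =1 h} -> hol_near JE JF x f -> hol_near JE JF x h.
Proof.
move=> fh [B [oB Bx [sf hf]]].
have [S [oS Sx SE]] : exists S, [/\ open S, S x & forall z, S z -> f z = h z].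
  exists [set z | f z = h z]°; split; [exact: open_interior|exact: fh|].
  exact: interior_subset.
exists (B `&` S); split; [exact: openI|by split|split].
  apply: (smooth_on_eq (f := f) (openI oB oS)); first by move=> z [_ /SE].
  by apply: smooth_on_sub sf; exact: subIsetl.
move=> z X [Bz Sz].
have nE : \forall z \near z, f z = h z.
  by apply: filterS (open_nbhs_nbhs (conj oS Sz)).
by rewrite -!(near_eq_derive _ nE); exact: hf.
Qed.

Lemma hol_near_comp (E F G : normedModType R) (JE : E -> E) (JF : F -> F) (JG : G -> G)
    x (f : E -> F) (h : F -> G) : finite_coordinates F ->
  hol_near JE JF x f -> hol_near JF JG (f x) h -> hol_near JE JG x (fun z => h (f z)).
Proof.
move=> cF [B [oB Bx [sf hf]]] [B' [oB' B'x [sh hh]]].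
have cf : forall z, B z -> {for z, continuous f}.
  by move=> z Bz; apply: differentiable_continuous; exact: smooth_on_diff sf Bz.
have oS : open (B `&` f @^-1` B').
  rewrite openE => z [Bz fz]; rewrite /interior; apply: filterI; first exact: open_nbhs_nbhs.
  by apply: (cf z Bz); exact: open_nbhs_nbhs.
exists (B `&` f @^-1` B'); split=> //; split.
  apply: (smooth_on_comp (V := B') cF oS _ _ sh); first by move=> z [].
  by apply: smooth_on_sub sf; exact: subIsetl.
move=> z X [Bz fz].
have df := smooth_on_diff sf Bz; have dh := smooth_on_diff sh fz.
by rewrite !(derive_comp (g := h) _ df dh) hf// hh.
Qed.

(** Naming the value [y] allows the second map to be given at a base point that equals [f x] only
    after a proof. *)
Lemma hol_near_comp_at (E F G : normedModType R) (JE : E -> E) (JF : F -> F) (JG : G -> G)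
    x (f : E -> F) (h : F -> G) y : finite_coordinates F ->
  hol_near JE JF x f -> f x = y -> hol_near JF JG y h -> hol_near JE JG x (fun z => h (f z)).
Proof. by move=> cF hf <-; exact: hol_near_comp. Qed.

Lemma hol_near_pair (E F G : normedModType R) (JE : E -> E) (JF : F -> F) (JG : G -> G)
    x (f : E -> F) (h : E -> G) :
  hol_near JE JF x f -> hol_near JE JG x h ->
  hol_near JE (fun p : F * G => (JF p.1, JG p.2)) x (fun z => (f z, h z)).
Proof.
move=> [B [oB Bx [sf hf]]] [B' [oB' B'x [sh hh]]].
have oS := openI oB oB'; exists (B `&` B'); split=> //; split.
  apply: smooth_on_pair => //; first by apply: smooth_on_sub sf; exact: subIsetl.
  by apply: smooth_on_sub sh; exact: subIsetr.
move=> z X [Bz B'z].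
have df := smooth_on_diff sf Bz; have dh := smooth_on_diff sh B'z.
by rewrite !(derive_pair _ df dh) hf// hh.
Qed.

Lemma hol_near_linear (E F : normedModType R) (JE : E -> E) (JF : F -> F) x (f : E -> F) :
  continuous_linear f -> (forall X, f (JE X) = JF (f X)) -> hol_near JE JF x f.
Proof.
move=> cf fJ; exists setT; split; [exact: openT|by []|split].
  exact: smooth_on_linear openT cf.
by move=> z X _; rewrite !(continuous_linear_derive _ _ cf).
Qed.

Lemma hol_near_cst (E F : normedModType R) (JE : E -> E) (JF : F -> F) x (y : F) :
  JF 0 = 0 -> hol_near JE JF x (cst y).
Proof.
move=> J0; exists setT; split; [exact: openT|by []|split].
  exact: smooth_on_cst openT.
by move=> z X _; rewrite !derive_cst.
Qed.

End HolomorphicNear.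

(** * Holomorphic maps and the group law read in charts *)

Section ChartMaps.
Context {R : realType} {n : nat}.
Local Notation E := (Cspace R n).
Local Notation hol := (hol_near (@mulI R n) (@mulI R n)).

Lemma near_cimg (T : topologicalType) (c : chart R n T) x :
  cimg c x -> \forall x \near x, cimg c x.
Proof. by move=> cx; apply: open_nbhs_nbhs; split=> //; exact: cimg_open. Qed.

Lemma near_cdom (T : topologicalType) (c : chart R n T) p :
  cdom c p -> \forall p \near p, cdom c p.
Proof. by move=> cp; apply: open_nbhs_nbhs; split=> //; exact: cdom_open. Qed.

Lemma loc_hol (M N : complexManifold R n) (B : set M) (f : M -> N) c d x :
  open B -> holomorphic_on B f -> atlas M c -> atlas N d -> cimg c x -> B (cinv c x) ->
  cdom d (f (cinv c x)) -> hol x (loc f c d).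
Proof.
move=> oB [cf hf] ac ad cx Bx dx; apply: hol_near_sub (hf c d ac ad).
have ci := cinv_cont cx.
apply: filterI; first apply: filterI; first exact: near_cimg.
  have fc : {for x, continuous (f \o cinv c)} by apply: continuous_comp => //; exact: cf.
  by apply: fc; exact: near_cdom.
by apply: ci; exact: open_nbhs_nbhs.
Qed.

Lemma lmul_hol (G : complexLieGroup R n) c1 c2 d (z : E * E) :
  atlas G c1 -> atlas G c2 -> atlas G d -> cimg c1 z.1 -> cimg c2 z.2 ->
  cdom d (lmul (cinv c1 z.1) (cinv c2 z.2)) ->
  hol_near (@mulI2 R n) (@mulI R n) z (fun z => cmap d (lmul (cinv c1 z.1) (cinv c2 z.2))).
Proof.
move=> a1 a2 ad z1 z2 dz; apply: hol_near_sub (lmul_holo a1 a2 ad).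
have ci1 : {for z, continuous (fun z : E * E => cinv c1 z.1)}.
  by apply: (continuous_comp (f := fst) (g := cinv c1)); [exact: cvg_fst|exact: cinv_cont z1].
have ci2 : {for z, continuous (fun z : E * E => cinv c2 z.2)}.
  by apply: (continuous_comp (f := snd) (g := cinv c2)); [exact: cvg_snd|exact: cinv_cont z2].
have cm : {for z, continuous (fun z : E * E => lmul (cinv c1 z.1) (cinv c2 z.2))}.
  apply: (continuous_comp (f := fun z : E * E => (cinv c1 z.1, cinv c2 z.2))
     (g := fun p : G * G => lmul p.1 p.2)); first exact: cvg_pair ci1 ci2.
  exact: lmul_cont.
have n1 : \forall w \near z, cimg c1 w.1 by apply: cvg_fst; exact: near_cimg.
have n2 : \forall w \near z, cimg c2 w.2 by apply: cvg_snd; exact: near_cimg.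
have n3 : \forall w \near z, cdom d (lmul (cinv c1 w.1) (cinv c2 w.2)).
  by apply: cm; exact: near_cdom.
by near=> w; split; near: w.
Unshelve. all: by end_near. Qed.

End ChartMaps.

(** In charts, [f] stands for the quotient map, [l] for a left translation and [p] for a local lift.
    The differential of [f] undoes that of [p], so [p] pulls [h0] back to [g0]; [l] preserves the
    metric of the group and [f] carries it to the quotient, so the composite [t] is isometric at
    [x0]. *)
Lemma isometry_chain (R : realType) (E : normedModType R) (f l p t : E -> E) (x0 y0 yx : E)
    (h0 h1 g0 g1 : E -> E -> R) :
  differentiable p x0 -> p x0 = y0 -> differentiable l y0 -> l y0 = yx ->
  differentiable f y0 -> differentiable f yx ->
  (\forall y \near x0, f (p y) = y) -> (\forall y \near x0, f (l (p y)) = t y) ->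
  (forall v w, h0 v w = h1 ('D_v l y0) ('D_w l y0)) ->
  (forall v w, h0 v w = g0 ('D_v f y0) ('D_w f y0)) ->
  (forall v w, h1 v w = g1 ('D_v f yx) ('D_w f yx)) ->
  forall v w, g1 ('D_v t x0) ('D_w t x0) = g0 v w.
Proof.
move=> dp <- dl <- dfy dfx fpK flp h01 h0g h1g v w.
have e1 u : 'D_('D_u p x0) f (p x0) = u.
  rewrite -(derive_comp (g := f) u dp dfy) (near_eq_derive u fpK).
  by rewrite derive_id.
have e2 u : 'D_u t x0 = 'D_('D_('D_u p x0) l (p x0)) f (l (p x0)).
  have dlp : differentiable (fun y => l (p y)) x0 by exact: (differentiable_comp dp dl).
  rewrite -(near_eq_derive u flp) (derive_comp (g := f) u dlp dfx).
  by rewrite (derive_comp (g := l) u dp dl).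
by rewrite !e2 -h1g -h01 h0g !e1.
Qed.

(** * Group law and invariance of the metric near a point of the quotient *)

Section QuotientLocalGroup.
Context {R : realType} {n : nat}.
Local Notation E := (Cspace R n).
Local Notation hol := (hol_near (@mulI R n) (@mulI R n)).
Variables (M : complexManifold R n) (G : complexLieGroup R n) (pi : G -> M).
Hypothesis pi_hol : holomorphic_on [set: G] pi.
Variables (c : chart R n M) (x0 : E).
Hypotheses (ac : atlas M c) (cx0 : cimg c x0).
Variables (p0 : G) (U : set G) (s : M -> G).
Hypotheses (pi0 : pi p0 = cinv c x0) (oU : open U) (Up0 : U p0) (opU : open (pi @` U)).
Hypotheses (s_hol : holomorphic_on (pi @` U) s) (sK : forall p, U p -> s (pi p) = p).
Variables (e b k : chart R n G).
Hypotheses (ae : atlas G e) (ab : atlas G b) (ak : atlas G k).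
Hypotheses (ep0 : cdom e p0) (b1 : cdom b (@lone _ _ G)) (kp0 : cdom k (linv p0)).

Let P (x : E) : G := s (cinv c x).
Let y0 := cmap e p0.
Let w0 := cmap b (@lone _ _ G).
(* With P lifting the chart c to G and P x0 = p0, the product P x . p0^-1 . P y read in
   the chart c has unit x0. *)
Let prod_at (z : E * E) : G := lmul (P z.1) (lmul (linv p0) (P z.2)).
Definition quotient_mul (z : E * E) : E := cmap c (pi (prod_at z)).
Local Notation m := quotient_mul.

Let q0U : (pi @` U) (cinv c x0).
Proof. by exists p0. Qed.

Let P0 : P x0 = p0.
Proof. by rewrite /P -pi0 sK. Qed.

Let ey0 : cimg e y0. Proof. exact: cmap_img. Qed.
Let bw0 : cimg b w0. Proof. exact: cmap_img. Qed.
Let ey0K : cinv e y0 = p0. Proof. exact: cmapK. Qed.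
Let bw0K : cinv b w0 = @lone _ _ G. Proof. exact: cmapK. Qed.

Let P_cont : {for x0, continuous P}.
Proof.
apply: (continuous_comp (f := cinv c) (g := s)); first exact: cinv_cont cx0.
exact: s_hol.1.
Qed.

Let near_P : \forall x \near x0, [/\ cimg c x, U (P x), pi (P x) = cinv c x & cdom e (P x)].
Proof.
have n1 := near_cimg cx0.
have n2 : \forall x \near x0, (pi @` U) (cinv c x).
  by apply: (cinv_cont cx0); apply: open_nbhs_nbhs.
have n3 : \forall x \near x0, cdom e (P x).
  by apply: P_cont; rewrite P0; exact: near_cdom.
near=> x.
have cx : cimg c x by near: x.
have [p Up pix] : (pi @` U) (cinv c x) by near: x.
have PE : P x = p by rewrite /P -pix sK.
split=> //; [by rewrite PE|by rewrite PE|by near: x].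
Unshelve. all: by end_near. Qed.

Let inv_P_cont : {for x0, continuous (fun x => lmul (linv p0) (P x))}.
Proof.
apply: (continuous_comp (f := fun x => (linv p0, P x)) (g := fun p : G * G => lmul p.1 p.2)).
  apply: cvg_pair; [exact: cvg_cst|exact: P_cont].
exact: lmul_cont.
Qed.

Let prod_cont : {for (x0, x0), continuous prod_at}.
Proof.
apply: (continuous_comp (f := fun z : E * E => (P z.1, lmul (linv p0) (P z.2)))
  (g := fun p : G * G => lmul p.1 p.2)); last exact: lmul_cont.
apply: cvg_pair.
  by apply: (continuous_comp (f := fst) (g := P)); [exact: cvg_fst|exact: P_cont].
apply: (continuous_comp (f := snd) (g := fun x => lmul (linv p0) (P x))).
  exact: cvg_snd.
exact: inv_P_cont.
Qed.

Let prod0 : prod_at (x0, x0) = p0.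
Proof. by rewrite /prod_at /= P0 lmulV lmulr1. Qed.

Let near_prod : \forall z \near (x0, x0),
  [/\ U (prod_at z), cdom c (pi (prod_at z)) & cdom e (prod_at z)].
Proof.
have near_set (S : set G) : nbhs p0 S -> \forall z \near (x0, x0), S (prod_at z).
  by move=> Sp; apply: prod_cont; rewrite prod0.
have n1 := near_set _ (open_nbhs_nbhs (conj oU Up0)).
have n2 : \forall z \near (x0, x0), cdom c (pi (prod_at z)).
  apply: (near_set [set p | cdom c (pi p)]); apply: (pi_hol.1 p0 I).
  by rewrite pi0; apply: near_cdom; exact: cinv_dom.
have n3 := near_set _ (near_cdom ep0).
by near=> z; split; near: z.
Unshelve. all: by end_near. Qed.

(** While the product stays in [U], its image under [pi] lifts back to the product itself and not to
    another point of the fiber. *)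
Let P_mul z : U (prod_at z) -> cdom c (pi (prod_at z)) -> P (m z) = prod_at z.
Proof. by move=> Uz cz; rewrite /P /m cmapK// sK. Qed.

(** Near [(x0, x0)] the law [m] is [phi (mu (Px x, N (Px y)))], a composite of maps between charts.
    The second factor [lmul (linv p0) (P y)] is close to the unit, so it is read in the chart [b],
    and the first factor in the chart [e] around [p0]. *)
Let Px := loc s c e.
Let phi := loc pi e c.
Let N (y : E) : E := cmap b (lmul (linv p0) (cinv e y)).
Let mu (z : E * E) : E := cmap e (lmul (cinv e z.1) (cinv b z.2)).

Let mulI0 : mulI (0 : E) = 0.
Proof. by rewrite /mulI /= oppr0. Qed.

Let Px_hol : hol x0 Px.
Proof. by apply: loc_hol s_hol ac ae cx0 q0U _; rewrite // -/(P x0) P0. Qed.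

Let Px0 : Px x0 = y0.
Proof. by rewrite /Px /loc -/(P x0) P0. Qed.

Let phi_hol : hol y0 phi.
Proof.
apply: loc_hol pi_hol ae ac ey0 _ _ => //; first exact: openT.
by rewrite ey0K pi0; exact: cinv_dom.
Qed.

Let mu_hol : hol_near (@mulI2 R n) (@mulI R n) (y0, w0) mu.
Proof. by apply: lmul_hol => //=; rewrite ey0K bw0K lmulr1. Qed.

(** Left multiplication by the fixed element [linv p0] is the group law with its first argument
    frozen at a point of the chart [k]. *)
Let N_hol : hol y0 N.
Proof.
pose v0 := cmap k (linv p0).
have kv0 : cimg k v0 by exact: cmap_img.
have kv0K : cinv k v0 = linv p0 by exact: cmapK.
have NE : N = fun y => cmap b (lmul (cinv k v0) (cinv e y)) by rewrite kv0K.
rewrite NE.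
have cEE : finite_coordinates (E * E)%type.
  exact: finite_coordinates_prod (finite_coordinates_Cspace n) (finite_coordinates_Cspace n).
have h1 : hol_near (@mulI R n) (@mulI2 R n) y0 (fun y => (v0, y)).
  apply: hol_near_pair; first exact: hol_near_cst.
  by apply: hol_near_linear => //; split=> // z; exact: cvg_id.
apply: (hol_near_comp (f := fun y => (v0, y))
  (h := fun z => cmap b (lmul (cinv k z.1) (cinv e z.2))) cEE h1).
by apply: lmul_hol => //=; rewrite kv0K ey0K lmulV.
Qed.

Let N0 : N y0 = w0.
Proof. by rewrite /N ey0K lmulV. Qed.

Let muE x y : cdom e (P x) -> cdom e (P y) -> cdom b (lmul (linv p0) (P y)) ->
  mu (Px x, N (Px y)) = cmap e (prod_at (x, y)).
Proof.
move=> ex ey bxy; rewrite /mu /N /Px /loc /= -/(P x) -/(P y).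
by rewrite (cmapK ex) (cmapK ey) (cmapK bxy).
Qed.

Let near_bP : \forall y \near x0, cdom b (lmul (linv p0) (P y)).
Proof. by apply: inv_P_cont; rewrite P0 lmulV; exact: near_cdom. Qed.

Let near_fst (S : set E) : nbhs x0 S -> \forall z \near (x0, x0), S z.1.
Proof. by move=> Sx; apply: cvg_fst. Qed.

Let near_snd (S : set E) : nbhs x0 S -> \forall z \near (x0, x0), S z.2.
Proof. by move=> Sx; apply: cvg_snd. Qed.

Let m_near : {near (x0, x0), (fun z => phi (mu (Px z.1, N (Px z.2)))) =1 m}.
Proof.
have n1 : \forall z \near (x0, x0),
    [/\ cimg c z.1, U (P z.1), pi (P z.1) = cinv c z.1 & cdom e (P z.1)].
  exact: (near_fst near_P).
have n2 : \forall z \near (x0, x0),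
    [/\ cimg c z.2, U (P z.2), pi (P z.2) = cinv c z.2 & cdom e (P z.2)].
  exact: (near_snd near_P).
have n3 : \forall z \near (x0, x0), cdom b (lmul (linv p0) (P z.2)).
  exact: (near_snd near_bP).
near=> z.
have [_ _ _ e1] : [/\ cimg c z.1, U (P z.1), pi (P z.1) = cinv c z.1 & cdom e (P z.1)].
  by near: z.
have [_ _ _ e2] : [/\ cimg c z.2, U (P z.2), pi (P z.2) = cinv c z.2 & cdom e (P z.2)].
  by near: z.
have bz : cdom b (lmul (linv p0) (P z.2)) by near: z.
have [_ _ ez] : [/\ U (prod_at z), cdom c (pi (prod_at z)) & cdom e (prod_at z)] by near: z.
rewrite (muE e1 e2 bz) /phi /loc /m.
by rewrite (cmapK (c := e)); [case: (z)|move: ez; case: (z)].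
Unshelve. all: by end_near. Qed.

Let m_hol : hol_near (@mulI2 R n) (@mulI R n) (x0, x0) m.
Proof.
apply: hol_near_eq m_near _.
have cE := finite_coordinates_Cspace (R := R) n.
have cEE := finite_coordinates_prod cE cE.
have hfst : hol_near (@mulI2 R n) (@mulI R n) (x0, x0) fst.
  by apply: hol_near_linear => //; exact: continuous_linear_fst.
have hsnd : hol_near (@mulI2 R n) (@mulI R n) (x0, x0) snd.
  by apply: hol_near_linear => //; exact: continuous_linear_snd.
have h1 := hol_near_comp_at cE hfst (erefl x0) Px_hol.
have h2 := hol_near_comp_at cE hsnd (erefl x0) Px_hol.
have h3 := hol_near_comp_at cE h2 Px0 N_hol.
have h4 := hol_near_pair h1 h3.
have e4 : (Px x0, N (Px x0)) = (y0, w0) := f_equal2 pair Px0 (etrans (f_equal N Px0) N0).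
have h5 := hol_near_comp_at cEE h4 e4 mu_hol.
have e5 : mu (Px x0, N (Px x0)) = y0.
  apply: etrans (f_equal mu e4) _; by rewrite /mu /= ey0K bw0K lmulr1.
exact: hol_near_comp_at cE h5 e5 phi_hol.
Qed.

(** A square neighbourhood: one condition on each of [x], [y], [z] then controls both inner products
    in the associativity law. *)
Let near_prod2 : exists S : set E, nbhs x0 S /\ forall x y, S x -> S y ->
  [/\ U (prod_at (x, y)), cdom c (pi (prod_at (x, y))) & cdom e (prod_at (x, y))].
Proof.
have [[S T] /= [Sx Ty] ST] := near_prod.
exists (S `&` T); split; first exact: filterI.
by move=> x y [Sx' _] [_ Ty']; exact: (ST (x, y)).
Qed.

(** As inner products lift to themselves, both sides of associativity are images of
    [P x p0^-1 P y p0^-1 P z]. The middle factor [p0^-1] makes [x0] a unit on both sides. *)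
Lemma quotient_local_group : exists W, local_group (@mulI R n) x0 W m.
Proof.
have [W [oW W0 [sW hW]]] := m_hol.
exists W; split=> //.
- apply: filterS near_P => x [cx Ux pix ex].
  by rewrite /m /prod_at /= P0 lmulV lmulr1 pix cinvK.
- apply: filterS near_P => x [cx Ux pix ex].
  by rewrite /m /prod_at /= P0 lmulA lmulVr lmul1 pix cinvK.
- have [S [Sx0 SP]] := near_prod2.
  apply: filterS (Sx0) => x Sx.
  apply: filterS (Sx0) => y Sy; apply: filterS (Sx0) => z Sz.
  have [U1 c1 _] := SP x y Sx Sy; have [U2 c2 _] := SP y z Sy Sz.
  rewrite [LHS]/m [RHS]/m /prod_at /= (P_mul U1 c1) (P_mul U2 c2) /prod_at /=.
  by rewrite !lmulA.
Qed.

(** In the chart, [m (x, .)] is a local lift, followed by a left translation of [G], followed by the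
    quotient map. Left invariance of [h] makes this composite isometric at [x0], and its
    differential there is the frame at [x]. *)
Lemma quotient_metric_invariant (h : hermitian_metric G) (g : hermitian_metric M) W :
  local_group (@mulI R n) x0 W m ->
  left_invariant h -> is_pullback pi (metric h) (metric g) ->
  \forall x \near x0, forall v w,
    metric g c x (frame x0 m x v) (frame x0 m x w) = metric g c x0 v w.
Proof.
move=> lg hl hg.
have dPx := nbhs_singleton (hol_near_diff Px_hol).
have cPx := differentiable_continuous dPx.
have n1 : \forall x \near x0, differentiable phi (Px x).
  have near_Px (S : set E) : nbhs y0 S -> \forall x \near x0, S (Px x).
    by move=> Sy; apply: cPx; rewrite Px0.
  exact: near_Px (hol_near_diff phi_hol).
have n2 : \forall x \near x0, differentiable mu (Px x, w0).
  have cp : {for x0, continuous (fun x => (Px x, w0))}.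
    have dp : differentiable (fun x => (Px x, w0)) x0.
      exact: differentiable_pair dPx (differentiable_cst w0 x0).
    exact: differentiable_continuous dp.
  have near_Px (S : set (E * E)) : nbhs (y0, w0) S -> \forall x \near x0, S (Px x, w0).
    by move=> Sy; apply: cp; rewrite Px0.
  exact: near_Px (hol_near_diff mu_hol).
have nW := near_frame_dom lg.
have [S [nS SP]] := near_prod2.
have phiP x : pi (P x) = cinv c x -> cimg c x -> cdom e (P x) -> phi (Px x) = x.
  by move=> pix cx ex; rewrite /phi /Px /loc (cmapK ex) pix cinvK.
have nphi : \forall y \near x0, phi (Px y) = y.
  by apply: filterS near_P => x [cx _ pix ex]; exact: phiP.
have nb : \forall y \near y0, cdom b (lmul (linv p0) (cinv e y)).
  have ce : {for y0, continuous (fun y => lmul (linv p0) (cinv e y))}.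
    apply: (continuous_comp (f := fun y => (linv p0, cinv e y))
      (g := fun p : G * G => lmul p.1 p.2)).
      by apply: cvg_pair; [exact: cvg_cst|exact: cinv_cont ey0].
    exact: lmul_cont.
  have near_ce (T : set G) : nbhs (@lone _ _ G) T ->
      \forall y \near y0, T (lmul (linv p0) (cinv e y)).
    by move=> Sy; apply: ce; rewrite ey0K lmulV.
  exact: near_ce (near_cdom b1).
near=> x.
have [cx Ux pix ex] : [/\ cimg c x, U (P x), pi (P x) = cinv c x & cdom e (P x)].
  by near: x; exact: near_P.
have Sx : S x by near: x.
have Wx : W (x, x0) by near: x.
have dphi : differentiable phi (Px x) by near: x.
have dmu : differentiable mu (Px x, w0) by near: x.
(* The element whose left translation takes [p0] to [P x]. *)
pose a := lmul (P x) (linv p0).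
pose L := loc (lmul a) e e.
(* Differentiability of the translation is drawn from that of the group law [mu] with its first
   argument fixed. *)
have muL : \forall y \near y0, mu (Px x, N y) = L y.
  apply: filterS nb => y by_; rewrite /mu /L /loc /N /= -/(P x) (cmapK ex) (cmapK by_).
  by rewrite /a lmulA.
have L0 : L y0 = Px x by rewrite /L /loc ey0K /a -lmulA lmulV lmulr1.
have dN := nbhs_singleton (hol_near_diff N_hol).
have dL : differentiable L y0.
  apply: near_eq_diff muL _.
  have dp : differentiable (fun y => (Px x, N y)) y0.
    exact: differentiable_pair (differentiable_cst (Px x) y0) dN.
  apply: (differentiable_comp (f := fun y => (Px x, N y)) (g := mu) dp).
  by rewrite /= N0.
have tE : \forall y \near x0, phi (L (Px y)) = m (x, y).
  apply: filterS2 near_P (nS) => y [cy Uy piy ey] Sy.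
  have [_ _ exy] := SP x y Sx Sy.
  rewrite /L /phi /Px /loc -/(P y) (cmapK ey) /a -lmulA.
  by rewrite (cmapK (c := e) (p := lmul (P x) (lmul (linv p0) (P y)))).
have aey0 : loc_dom (lmul a) e e y0.
  by split; rewrite // ey0K /a -lmulA lmulV lmulr1.
have piy0 : loc_dom pi e c y0 by split; rewrite // ey0K pi0; exact: cinv_dom.
have pixx : loc_dom pi e c (Px x).
  split; first exact: cmap_img.
  by rewrite /Px /loc (cmapK ex) pix; exact: cinv_dom.
have phi0 : phi y0 = x0 by rewrite -Px0 phiP// ?P0.
have phix : phi (Px x) = x by exact: phiP.
have main := isometry_chain dPx Px0 dL L0 (nbhs_singleton (hol_near_diff phi_hol)) dphi nphi tE
  (h0 := metric h e y0) (h1 := metric h e (Px x)) (g0 := metric g c x0) (g1 := metric g c x).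
move=> v w.
have fE u := frameE lg u Wx.
apply: etrans (f_equal2 (metric g c x) (fE v) (fE w)) _; apply: main => v' w'.
- by have := hl a e e ae ae y0 aey0 v' w'; rewrite -/L L0.
- by have := hg e c ae ac y0 piy0 v' w'; rewrite -/phi phi0.
- by have := hg e c ae ac (Px x) pixx v' w'; rewrite -/phi phix.
Unshelve. all: by end_near. Qed.

End QuotientLocalGroup.

(** * From local groups to the Ricci forms of the quotient *)

Section RicciFlat.
Context {R : realType} {n : nat} {M : complexManifold R n}.
Local Notation E := (Cspace R n).

Lemma Im_traceC (f : E -> E) : complex.Im (traceC f) = imtr f.
Proof. by rewrite /traceC /imtr; elim/big_rec2: _ => //= k y z _ <-; case: z. Qed.

Lemma ricci_formE (D : christoffel M) c x X Y : ricci_form D c x X Y =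
  'D_X (fun z => imtr (D c z Y)) x - 'D_Y (fun z => imtr (D c z X)) x.
Proof.
have e Z : (fun z => complex.Im (anticanonical_form D c z Z)) = (fun z => imtr (D c z Z)).
  by apply/funext => z; exact: Im_traceC.
by rewrite /ricci_form /= !e.
Qed.

Lemma affine_connection_diff (D : christoffel M) c x X Y :
  is_affine_connection D -> atlas M c -> cimg c x -> differentiable (fun z => D c z X Y) x.
Proof. by case=> sm _ _ _ ac cx; exact: smooth_on_diff (sm c X Y ac) cx. Qed.

Lemma ricci_flat_combination (g : hermitian_metric M) t (D : christoffel M) :
  (forall D', is_chern g D' -> ricci_flat D') ->
  (forall D', is_bismut g D' -> ricci_flat D') ->
  is_canonical g t D -> ricci_flat D.
Proof.
move=> fc fb [Dc [Db [cD bD DE]]] c x ac cx X Y.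
(* Differentiability of the two traces allows the derivative of their affine combination to be
   split. *)
have dc Z : differentiable (fun z => imtr (Dc c z Z)) x.
  apply: (derive_imtr (F := fun z => Dc c z Z) 0 _).1 => w.
  by apply: affine_connection_diff => //; case: cD => [[]].
have db Z : differentiable (fun z => imtr (Db c z Z)) x.
  apply: (derive_imtr (F := fun z => Db c z Z) 0 _).1 => w.
  by apply: affine_connection_diff => //; case: bD => [[]].
have tE Z V : 'D_V (fun z => imtr (D c z Z)) x =
    (1 + t) / 2 * 'D_V (fun z => imtr (Dc c z Z)) x +
    (1 - t) / 2 * 'D_V (fun z => imtr (Db c z Z)) x.
  have e : (fun z => imtr (D c z Z)) =
     fun z => (1 + t) / 2 *: imtr (Dc c z Z) + (1 - t) / 2 *: imtr (Db c z Z).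
    apply/funext => z; rewrite /imtr !scaler_sumr -big_split; apply: eq_bigr => k _.
    by rewrite DE /= !mxE.
  rewrite e derive_add; [|exact: differentiableZ|exact: differentiableZ].
  by rewrite !derive_scale.
have fc' := fc Dc cD c x ac cx X Y; have fb' := fb Db bD c x ac cx X Y.
move: fc' fb'; rewrite !ricci_formE !tE => /eqP + /eqP.
by rewrite !subr_eq0 => /eqP -> /eqP ->; rewrite subrr.
Qed.

(** Any lift [p0] of the point will do, with a local inverse of [pi] near it and charts of [G]
    around [p0], the unit and the inverse of [p0]. *)
Lemma quotient_local_model (G : complexLieGroup R n) (Gam : set G) (pi : G -> M)
    (g : hermitian_metric M) c x0 :
  is_quotient Gam pi -> induced_by_left_invariant pi g -> atlas M c -> cimg c x0 ->
  exists W m, local_group (@mulI R n) x0 W m /\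
    \forall x \near x0, forall v w,
      metric g c x (frame x0 m x v) (frame x0 m x w) = metric g c x0 v w.
Proof.
move=> [pi_onto _ pi_hol pi_sec] [h [hl hg]] ac cx0.
have [p0 pi0] := pi_onto (cinv c x0).
have [U [s [oU Up0 opU s_hol sK]]] := pi_sec p0.
have [e [ae ep0]] := atlas_cover p0.
have [b [ab b1]] := atlas_cover (@lone _ _ G).
have [k [ak kp0]] := atlas_cover (linv p0).
have [W lg] := quotient_local_group pi_hol ac cx0 pi0 oU Up0 opU s_hol sK ae ab ak ep0 b1 kp0.
exists W, (quotient_mul pi c p0 s); split=> //.
exact: (quotient_metric_invariant pi_hol ac cx0 pi0 oU Up0 opU s_hol sK
  ae ab ak ep0 b1 kp0 lg hl hg).
Qed.

Lemma hermitian_connection_local (g : hermitian_metric M) (D : christoffel M) c x0 m :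
  atlas M c -> cimg c x0 -> is_hermitian_connection g D ->
  (\forall x \near x0, forall v w,
      metric g c x (frame x0 m x v) (frame x0 m x w) = metric g c x0 v w) ->
  local_hermitian (@mulI R n) x0 m (cimg c) (metric g c) (D c).
Proof.
move=> ac cx0 [[sm lr ll _] compat DJ] inv; split=> //.
- exact: cimg_open.
- by move=> X Y x cx; exact: smooth_on_diff (sm c X Y ac) cx.
- by move=> Y x cx; exact: ll.
- by move=> X x cx; exact: lr.
- by move=> x X Y cx; exact: DJ.
- by move=> X Y x cx; exact: smooth_on_diff (metric_smooth g X Y ac) cx.
- by move=> X x cx a Y Z; exact: (metric_linear g ac cx).
- by move=> x X Y cx; exact: (Defs.metric_sym g ac cx).
- by move=> x X cx; exact: (metric_pos g ac cx).
- by move=> x X Y cx; exact: (metric_J g ac cx).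
- by move=> x X Y Z cx; exact: (compat c x ac cx).
Qed.

End RicciFlat.

Theorem theorem5 (R : realType) (n : nat) (M : complexManifold R n)
    (M_compact : compact [set: M])
    (M_parallelizable : complex_parallelizable M)
    (G : complexLieGroup R n) (Gam : set G) (Gam_discrete : discrete_subgroup Gam)
    (pi : G -> M) (M_quotient : is_quotient Gam pi)
    (g : hermitian_metric M)
    (g_left_invariant : induced_by_left_invariant pi g) :
  is_CYT g /\
  forall (t : R) (D : christoffel M), is_canonical g t D -> ricci_flat D.
Proof.
have bismut_flat D : is_bismut g D -> ricci_flat D.
  move=> [hD ts] c x ac cx X Y.
  have [W [m [lg inv]]] := quotient_local_model M_quotient g_left_invariant ac cx.
  rewrite ricci_formE.
  apply: (local_bismut_flat lg (hermitian_connection_local ac cx hD inv)) => z X' Y' Z' cz.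
  exact: ts.
have chern_flat D : is_chern g D -> ricci_flat D.
  move=> [hD ch] c x ac cx X Y.
  have [W [m [lg inv]]] := quotient_local_model M_quotient g_left_invariant ac cx.
  rewrite ricci_formE.
  apply: (local_chern_flat lg (hermitian_connection_local ac cx hD inv)) => z X' Y' cz.
  exact: ch.
split=> [//|t D]; exact: ricci_flat_combination.
Qed.
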